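(* Let $L\subset\mathbb{S}^3$ be a positive braid link. Then more than one-quarter of the zeroes of the Alexander polynomial of $L$ lie on the unit circle $\{z\in\mathbb{C} : |z|=1\}$.
   Context: A positive braid on $n+1$ strands is a product of positive powers of the standard generators $\sigma_1,\dots,\sigma_n$ of the braid group $B_{n+1}$. A positive braid link is an oriented link that is the closure of a positive braid, with all strands oriented in parallel. The Alexander polynomial of an oriented link $L$ is the one-variable polynomial $\Delta_L(t)=\det(V-tV^{T})$, where $V$ is a Seifert matrix of a connected Seifert surface for $L$; it is well defined up to multiplication by units $\pm t^k$.
   Formalization: The Alexander polynomial is assumed nonzero (it vanishes for split links) and to have at least one zero (the unknot has none); zeroes are counted with multiplicity, and 0 is ignored since the polynomial is defined up to units ±t^k. *)

(* Defs.v *)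
From HB Require Import structures.
From mathcomp Require Import all_boot all_order all_algebra.
From mathcomp Require Import complex.
From mathcomp Require Import reals.
Set Implicit Arguments.
Unset Strict Implicit.
Unset Printing Implicit Defensive.
Import Order.TTheory GRing.Theory Num.Theory.
Local Open Scope ring_scope.

(* The letter (i, true) is the braid generator that crosses strands i and     *)
(* i + 1 positively, (i, false) is its inverse; there are n generators on     *)
(* n + 1 strands. An oriented link is presented as the closure of a braid     *)
(* word, with all strands oriented in parallel.                               *)
Definition braid_word (n : nat) := seq ('I_n * bool).

Definition positive_word n (w : braid_word n) := all snd w.

(* The same closed braid, with a cancelling pair of letters appended for each *)
(* generator that does not occur in w, so that the surface below becomes      *)
(* connected. If every generator occurs in w, this is w itself.               *)
Definition connecting_word n (w : braid_word n) : braid_word n :=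
  w ++ flatten [seq [:: (i, true); (i, false)]
               | i <- enum 'I_n & i \notin [seq l.1 | l <- w]].

(* Seifert's algorithm applied to the closure of w yields a surface F made of *)
(* n + 1 horizontal discs 0, ..., n, stacked upwards and oriented by their    *)
(* upper side, and of one half-twisted band for each letter of w: the band of *)
(* a letter (i, _) joins the discs i and i + 1. The bands are attached along  *)
(* the front of the discs, in the order of the letters from left to right.    *)
Section SeifertSurface.
Variables (n : nat) (w : braid_word n).

Let column (k : 'I_(size w)) : nat := (tnth (in_tuple w) k).1.
Let sign (k : 'I_(size w)) : bool := (tnth (in_tuple w) k).2.

(* F retracts onto the graph with the discs as vertices and the bands as      *)
(* edges, so H_1(F; Z) is the group of the x : 'rV[int]_(size w) such that    *)
(* x *m band_boundary = 0; here x 0 k counts the upward passages of the       *)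
(* cycle x through the band k.                                                *)
Definition band_boundary : 'M[int]_(size w, n.+1) :=
  \matrix_(k, j) (((j : nat) == (column k).+1)%:R
                  - ((j : nat) == column k)%:R).

(* On cycles x, y the linking number lk(x, y^+), where y^+ is y pushed off F  *)
(* to the positive side, equals x *m band_linking *m y^T. It is the signed    *)
(* count of the crossings, seen from the front, at which y^+ passes over x.   *)
(* A strand of y^+ in the band l meets the front edge of the upper disc j of  *)
(* this band, where y^+ passes over the strands of x that run along the disc  *)
(* j. Their net flow to the right is the sum of - x 0 k over the bands k to   *)
(* the right of l that enter j from below, plus the sum of x 0 k over those   *)
(* that leave j upwards; a crossing of y^+ going up with x going right is     *)
(* negative. Where l meets its lower disc, y^+ is behind and passes over      *)
(* nothing. In a band traversed by both x and y, with y^+ drawn slightly to   *)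
(* the right of x at both ends, y^+ turns from the front to the back through  *)
(* the right if the letter is positive, without a crossing, and through the   *)
(* left if it is negative, with one positive crossing of y^+ over x when both *)
(* go up. In particular a cycle through two positive bands between the same   *)
(* discs has self-linking -1, as in a positive Hopf band.                     *)
Definition band_linking : 'M[int]_(size w) :=
  \matrix_(k, l)
    (if (l < k)%N then (column k == column l)%:R
                       - (column k == (column l).+1)%:R
     else ((k == l) && ~~ sign l)%:R).

Definition homology_basis r (B : 'M[int]_(r, size w)) : Prop :=
  B *m band_boundary = 0 /\
  forall x : 'rV[int]_(size w), x *m band_boundary = 0 ->
    exists! c : 'rV[int]_r, x = c *m B.

Definition seifert_matrix r (V : 'M[int]_r) : Prop :=
  exists2 B : 'M[int]_(r, size w),
    homology_basis B & V = B *m band_linking *m B^T.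

End SeifertSurface.

(* P represents the Alexander polynomial of the closure of w, which is        *)
(* defined up to multiplication by units +-t^k of Z[t, t^-1].                 *)
Definition alexander_polynomial n (w : braid_word n) (P : {poly int}) : Prop :=
  exists r (V : 'M[int]_r), seifert_matrix (connecting_word w) V /\
  exists (a b : nat) (e : bool),
    'X^a * P =
    (-1) ^+ e * 'X^b * \det (map_mx polyC V - 'X *: map_mx polyC V^T).

(* s lists with multiplicity the zeroes of P, which is nonzero. The zero 0 is *)
(* left out, since its multiplicity changes under multiplication by t^k.      *)
Definition laurent_zeroes (C : fieldType) (P : {poly C}) (s : seq C) : Prop :=
  0 \notin s /\
  exists (c : C) (k : nat),
    c != 0 /\ P = c *: ('X^k * \prod_(z <- s) ('X - z%:P)).

(* Main.v *)
Require Import Defs.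
From mathcomp Require Import all_boot all_order all_algebra.
From mathcomp Require Import complex.
From mathcomp Require Import reals.
From mathcomp Require Import ring lra zify.
Set Implicit Arguments.
Unset Strict Implicit.
Unset Printing Implicit Defensive.
Import Order.TTheory GRing.Theory Num.Theory.
Local Open Scope ring_scope.

(** Two facts combine: a bound from below on the number of zeroes on the unit
circle by the dimension of a semidefinite subspace, and the construction of a
large such subspace for a positive braid.

Let V be a matrix of size r, and suppose that V + V^T is negative semidefinite
on a space of dimension k. If det (V - t V^T) does not vanish identically, at
least 2k - r of its zeroes lie on the unit circle ([unit_circle_roots]). Indeed
a zero z with |z| < 1 yields an isotropic vector v with v V = z v V^*, and
passing to the quotient of its orthogonal by v lowers r by 2 and k by at most 1,
while z and its mirror image 1 / conj z are lost. Once no zero lies in the open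
disc, the symmetry in the circle puts all of them on the circle. As there are
at most r zeroes, 8k > 5r gives 2k - r > r / 4, which is the claim.

Call the letters that repeat one generator a column. A cycle on the surface of
a word is an integral weight x on the letters whose sum over each column
vanishes, so that r is the number of letters minus the number of columns
([homology_rank]). For a positive word, -2 lk(x, x^+) is
  Q(x) = sum x_k^2 + 2 sum x_l x_k,
the second sum being over the letters l < k with k in the column to the right
of that of l ([linking_form]). If a generator does not occur in the word, the
determinant vanishes ([missing_generator]).

So Q has to be nonnegative on a space of more than 5r / 8 weights
([nonneg_index_excess]). The form Q does not change when the word is rotated,
when a letter alone in its column is removed, or when i (i+1) i is replaced by
(i+1) i (i+1), possibly with letters in between that commute with these. The
last step raises the indices, so that it can be done only finitely often. In
the end each column has two letters or more. Call region a cyclic gap between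
consecutive letters of a column, and degree of a region the number of letters
of the two adjacent columns in it; then also no region contains a single letter
of the right column and none of the left one.

In such a word fix a parity. Columns of the other parity receive arbitrary
weights of sum zero; in the columns of the chosen parity let
x_k = f(k) - f(previous k) for a function f on the regions. Completing squares
gives
  Q(x) >= sum (f(k) - f(previous k))^2 - sum (f(left of l) - f(right of l))^2,
with l over the letters of the other parity and the two regions that contain l
([form_bound]). This is nonnegative if f lives on a set X of regions, no letter
is between two regions of X, and each region of X has a degree at most the
number of its two neighbours in the column that are outside X
([selection_bound]).

To find large sets X, each region of degree d receives 3 - d marks, or none if
d > 3, in such a way that for each mark the regions that carry it satisfy the
last condition; only one region in each column, of largest degree, has to be
left blank ([solvableP], [exists_labels]). Eight sets X are read off from the
marks ([selected]). In all they have sum (3 - d) elements, at least r + 1,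
since the mean degree is less than 2 ([weight_total]). A letter is free to have
any weight in four of the eight cases, apart from one letter in each column. The
dimensions of the eight families add up to at least 5r + 1, so one of them
exceeds 5r / 8 ([normal_index]). *)

(** * Zeroes on the unit circle from semidefiniteness *)

Section UnitCircle.
Variable C : numClosedFieldType.

Definition conjtr m n (A : 'M[C]_(m, n)) : 'M[C]_(n, m) := map_mx Num.conj A^T.

Lemma conjtrM m n p (A : 'M[C]_(m, n)) (B : 'M[C]_(n, p)) :
  conjtr (A *m B) = conjtr B *m conjtr A.
Proof. by rewrite /conjtr trmx_mul map_mxM. Qed.

Lemma conjtrK m n (A : 'M[C]_(m, n)) : conjtr (conjtr A) = A.
Proof. by apply/matrixP=> i j; rewrite !mxE conjCK. Qed.

Lemma conjtrD m n (A B : 'M[C]_(m, n)) : conjtr (A + B) = conjtr A + conjtr B.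
Proof. by apply/matrixP=> i j; rewrite !mxE rmorphD. Qed.

Lemma conjtrZ m n a (A : 'M[C]_(m, n)) : conjtr (a *: A) = a^* *: conjtr A.
Proof. by apply/matrixP=> i j; rewrite !mxE rmorphM. Qed.

Lemma conjtr0 m n : conjtr (0 : 'M[C]_(m, n)) = 0.
Proof. by apply/matrixP=> i j; rewrite !mxE rmorph0. Qed.

Lemma conjtr1 n : conjtr (1%:M : 'M[C]_n) = 1%:M.
Proof. by rewrite /conjtr trmx1 map_mx1. Qed.

Lemma conjtr_eq0 m n (A : 'M[C]_(m, n)) : (conjtr A == 0) = (A == 0).
Proof.
by apply/eqP/eqP => [h|->]; [rewrite -[A]conjtrK h conjtr0 | rewrite conjtr0].
Qed.

Lemma det_ct n (A : 'M[C]_n) : \det (conjtr A) = (\det A)^*.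
Proof. by rewrite /conjtr det_map_mx det_tr. Qed.

Lemma conjtr_unit n (A : 'M[C]_n) : (conjtr A \in unitmx) = (A \in unitmx).
Proof. by rewrite /conjtr map_unitmx unitmx_tr. Qed.

Lemma conjtr_row_mx m n1 n2 (A : 'M[C]_(m, n1)) (B : 'M[C]_(m, n2)) :
  conjtr (row_mx A B) = col_mx (conjtr A) (conjtr B).
Proof. by rewrite /conjtr tr_row_mx map_col_mx. Qed.

Lemma conjtr_col_mx m1 m2 n (A : 'M[C]_(m1, n)) (B : 'M[C]_(m2, n)) :
  conjtr (col_mx A B) = row_mx (conjtr A) (conjtr B).
Proof. by rewrite /conjtr tr_col_mx map_row_mx. Qed.

Lemma conjtr_block m1 m2 n1 n2 (A : 'M[C]_(m1, n1)) B D (E : 'M[C]_(m2, n2)) :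
  conjtr (block_mx A B D E) = block_mx (conjtr A) (conjtr D) (conjtr B) (conjtr E).
Proof. by rewrite /conjtr tr_block_mx map_block_mx. Qed.

Definition pencil_mx n (V : 'M[C]_n) : 'M[{poly C}]_n :=
  map_mx polyC V - 'X *: map_mx polyC (conjtr V).

Definition pencil n (V : 'M[C]_n) : {poly C} := \det (pencil_mx V).

Lemma horner_pencil n (V : 'M[C]_n) z : (pencil V).[z] = \det (V - z *: conjtr V).
Proof.
rewrite /pencil -[_.[z]]/(horner_eval z _) -det_map_mx; congr (\det _).
apply/matrixP=> i j; rewrite !mxE /= /horner_eval.
by rewrite hornerD hornerN hornerM hornerX !hornerC.
Qed.

(** A change of basis V -> G V G^* multiplies the pencil by |det G|^2, so it keeps
the zeroes. *)
Lemma pencil_congr n (G V : 'M[C]_n) : pencil (G *m V *m conjtr G) =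
  (\det G * (\det G)^*)%:P * pencil V.
Proof.
rewrite /pencil; have -> : pencil_mx (G *m V *m conjtr G) =
    map_mx polyC G *m pencil_mx V *m map_mx polyC (conjtr G).
  rewrite /pencil_mx !conjtrM conjtrK mulmxA mulmxBr mulmxBl -!map_mxM /=.
  by rewrite -scalemxAr -scalemxAl -!map_mxM /=.
rewrite !det_mulmx (det_map_mx _ G) (det_map_mx _ (conjtr G)) det_ct polyCM /=.
ring.
Qed.

Lemma delta_row n : delta_mx 0 0 = row_mx 1%:M 0 :> 'rV[C]_(1 + n).
Proof.
apply/matrixP=> i j; rewrite !mxE ord1.
by case: splitP => k ek; rewrite !mxE -[j == 0]val_eqE /= ek ?ord1.
Qed.

(** Every nonzero vector is the first vector of some basis. *)
Lemma row_delta_unit n (v : 'rV[C]_(1 + n)) : v != 0 ->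
  exists2 G : 'M[C]_(1 + n), G \in unitmx & row_mx 1%:M 0 *m G = v.
Proof.
move=> v0; have rv : \rank v = 1%N by rewrite rank_rV v0.
have /= := mulmx_ebase v; rewrite rv => lin_eval.
have pid : (pid_mx 1 : 'M[C]_(1, 1 + n)) = delta_mx 0 0.
  by apply/matrixP=> i j; rewrite !mxE !ord1 /= andbT eq_sym.
have ec : col_ebase v = (col_ebase v 0 0)%:M by rewrite -mx11_scalar.
have uc : col_ebase v 0 0 != 0.
  by have := col_ebase_unit v; rewrite unitmxE ec det_scalar1 unitfE mxE.
exists (col_ebase v 0 0 *: row_ebase v).
  by rewrite unitmxZ ?row_ebase_unit // unitfE.
by rewrite -delta_row -scalemxAr -{3}lin_eval {2}ec pid -!mulmxA mul_scalar_mx.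
Qed.

Lemma top_row m n (A : 'M[C]_(1 + m, n)) : row_mx 1%:M 0 *m A = usubmx A.
Proof. by rewrite -[A in LHS]vsubmxK mul_row_col mul1mx mul0mx addr0. Qed.

Lemma contract_norm (z a : C) : `|z| < 1 -> a^* = z * a -> a = 0.
Proof.
move=> z1 /(congr1 Num.norm); rewrite norm_conjC normrM => h.
apply/eqP; rewrite -normr_eq0; apply: contraTT z1 => a0.
have : `|z| * `|a| = 1 * `|a| by rewrite -h mul1r.
by move/(mulIf a0) ->; rewrite ltxx.
Qed.

(** The vector v of the kernel of V - z V^* satisfies v V = z phi with
phi = v V^*. The value a of phi on v satisfies conj a = z a, hence is 0 as
|z| < 1 ([contract_norm]). So v may be taken as the first basis vector, with
phi as the second coordinate form: the first row of V is then (0, z, 0) and the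
first column (0, 1, 0). *)
Lemma deflation m (V : 'M[C]_(1 + (1 + m))) (z : C) :
  `|z| < 1 -> pencil V != 0 -> root (pencil V) z ->
  exists2 G : 'M[C]_(1 + (1 + m)), G \in unitmx &
  exists W, G *m V *m conjtr G =
    block_mx 0 (row_mx z%:M 0) (col_mx 1%:M 0) W.
Proof.
move=> z1 p0; rewrite rootE horner_pencil => /det0P [v v0 /eqP].
rewrite mulmxBr -scalemxAr subr_eq0 => /eqP vV.
(* phi is nonzero, since v would otherwise be in the kernel of the whole pencil. *)
pose phi := v *m conjtr V.
have phi0 : phi != 0.
  apply: contraNneq p0 => e; apply/det0P; exists (map_mx polyC v).
    by rewrite map_mx_eq0.
  by rewrite mulmxBr -scalemxAr -!map_mxM /= vV -/phi e scaler0 !map_mx0 scaler0 subr0.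
have phiv : phi *m conjtr v = 0.
  apply/matrixP=> i j; rewrite !ord1 [RHS]mxE.
  apply: (contract_norm z1).
  transitivity ((conjtr (phi *m conjtr v)) 0 0); first by rewrite !mxE.
  by rewrite conjtrM /phi conjtrM !conjtrK mulmxA vV -scalemxAl mxE.
have [G1 uG1 eG1] := row_delta_unit v0.
have G1phi : lsubmx (phi *m conjtr G1 : 'rV_(1 + _)) = 0.
  rewrite -[lsubmx _]conjtrK -[LHS]conjtrK; apply/eqP; rewrite conjtr_eq0 conjtrK.
  have -> : conjtr (lsubmx (phi *m conjtr G1)) = usubmx (conjtr (phi *m conjtr G1)).
    by apply/matrixP=> i j; rewrite !mxE.
  by rewrite -top_row conjtrM conjtrK mulmxA eG1 -[v]conjtrK -conjtrM phiv conjtr0.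
pose psi := rsubmx (phi *m conjtr G1 : 'rV_(1 + _)).
have epsi : phi *m conjtr G1 = row_mx 0 psi by rewrite -G1phi hsubmxK.
have psi0 : psi != 0.
  apply: contraNneq phi0 => e.
  by rewrite -[phi](mulmxK (_ : conjtr G1 \in unitmx)) ?conjtr_unit // epsi e row_mx0 mul0mx.
have [H uH eH] := row_delta_unit psi0.
(* Change the last coordinates so that psi becomes the first of them. *)
pose H2 := conjtr (invmx H).
pose G2 : 'M[C]_(1 + (1 + m)) := block_mx 1%:M 0 0 H2.
pose G := G2 *m G1.
have uG : G \in unitmx.
  rewrite unitmx_mul uG1 andbT unitmxE det_ublock det1 mul1r -unitmxE.
  by rewrite conjtr_unit unitmx_inv.
have e0G : row_mx 1%:M 0 *m G = v.
  by rewrite mulmxA -eG1 /G2 mul_row_block !(mul0mx, mul1mx, addr0, mulmx0).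
have rG : phi *m conjtr G = row_mx 0 (row_mx 1%:M 0).
  rewrite conjtrM mulmxA epsi /G2 conjtr_block mul_row_block !conjtr0 !mul0mx !mulmx0 !add0r.
  by rewrite conjtrK -eH mulmxK.
clearbody G.
have uV : usubmx (G *m V *m conjtr G) = row_mx 0 (row_mx z%:M 0).
  rewrite -top_row !mulmxA e0G vV -scalemxAl rG !scale_row_mx !scaler0.
  by rewrite scalemx1.
have lV : lsubmx (G *m V *m conjtr G) = col_mx 0 (col_mx 1%:M 0).
  rewrite -[LHS]conjtrK.
  have -> : conjtr (lsubmx (G *m V *m conjtr G)) = usubmx (conjtr (G *m V *m conjtr G)).
    by apply/matrixP=> i j; rewrite !mxE.
  have -> : conjtr (G *m V *m conjtr G) = G *m (conjtr V *m conjtr G) by rewrite !conjtrM conjtrK.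
  by rewrite -top_row !mulmxA e0G -/phi rG !conjtr_row_mx !conjtr0 conjtr1.
exists G => //; exists (drsubmx (G *m V *m conjtr G)).
rewrite -[LHS]submxK; congr block_mx.
- by rewrite /ulsubmx uV row_mxKl.
- by rewrite /ursubmx uV row_mxKr.
have -> : dlsubmx (G *m V *m conjtr G) = dsubmx (lsubmx (G *m V *m conjtr G)).
  by apply/matrixP=> i j; rewrite !mxE.
by rewrite lV col_mxKd.
Qed.

(** The first row of the pencil of V is (0, z - X, 0) and the first column is
(0, 1 - conj z X, 0), so exchanging the first two columns makes it block
triangular. The constant e is a sign that comes from this exchange. *)
Lemma pencil_block m (z : C) a b c (d : 'M[C]_m) :
  let V : 'M[C]_(1 + (1 + m)) :=
    block_mx 0 (row_mx z%:M 0) (col_mx 1%:M 0) (block_mx a b c d) in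
  exists2 e, e != 0 &
  pencil V = e%:P * (('X - z%:P) * (1 - z^* *: 'X)) * pencil d.
Proof.
move=> V.
(* The matrix of this transposition; its determinant is kept abstract. *)
pose J : 'M[C]_(1 + (1 + m)) :=
  block_mx 0 (row_mx 1%:M 0) (col_mx 1%:M 0) (block_mx 0 0 0 1%:M).
have JJ : J *m J = 1%:M.
  rewrite /J mulmx_block mul_row_col mul_row_block mul_block_col mul_col_row.
  rewrite mulmx_block !(mul0mx, mulmx0, mul1mx, mulmx1, add0r, addr0).
  by rewrite add_block_mx !(add0r, addr0) row_mx0 col_mx0 -!scalar_mx_block.
have dJ : \det J != 0.
  by rewrite -unitfE -unitmxE; apply: (mulmx1_unit JJ).1.
exists (- (\det J)^-1); first by rewrite oppr_eq0 invr_eq0.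
have : pencil V * (\det J)%:P = (z%:P - 'X) * (1 - z^* *: 'X) * pencil d.
  rewrite -det_map_mx /= -det_mulmx.
  have -> : pencil_mx V *m map_mx polyC J =
    block_mx (z%:P - 'X)%:M 0
     (col_mx ((a 0 0)%:P - (a 0 0)^* *: 'X)%:M (map_mx polyC c - 'X *: map_mx polyC (conjtr b)))
     (block_mx (1 - z^* *: 'X)%:M (map_mx polyC b - 'X *: map_mx polyC (conjtr c)) 0 (pencil_mx d)).
    rewrite /pencil_mx /V /J !conjtr_block conjtr_row_mx conjtr_col_mx !conjtr0.
    rewrite !map_block_mx !map_row_mx !map_col_mx !map_mx0 !map_mx1.
    rewrite !scale_block_mx !scale_row_mx !scale_col_mx !scaler0 !opp_block_mx.
    rewrite !opp_row_mx !opp_col_mx !oppr0 !add_block_mx !add_row_mx !add_col_mx.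
    rewrite !addr0 mulmx_block mul_row_col !mul_row_block.
    rewrite mul_block_col mul_col_row mulmx_block.
    rewrite !(mul0mx, mulmx0, mul1mx, mulmx1, add0r, addr0).
    rewrite /pencil_mx; congr block_mx.
    - by apply/matrixP=> i j; rewrite !mxE !ord1 rmorph1 !mulr1n mulr1.
    - by rewrite row_mx0.
    - congr col_mx; apply/matrixP=> i j.
      by rewrite !mxE !ord1 !mulr1n -mul_polyC mulrC.
    rewrite add_block_mx !(addr0, add0r); congr block_mx.
    by apply/matrixP=> i j; rewrite !mxE !ord1 !mulr1n -mul_polyC mulrC.
  by rewrite det_lblock det_ublock !det_scalar1 mulrA.
move=> h.
have eJ : (\det J)%:P * (- (\det J)^-1)%:P = -1 :> {poly C}.
  by rewrite -polyCM mulrN mulfV // rmorphN.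
have -> : pencil V = - (pencil V * (\det J)%:P * (- (\det J)^-1)%:P).
  by rewrite -mulrA eJ mulrN1 opprK.
rewrite h; ring.
Qed.

Definition herm n (V : 'M[C]_n) (x : 'rV[C]_n) : C :=
  (x *m (V + conjtr V) *m conjtr x) 0 0.

Lemma hermE n (V : 'M[C]_n) x :
  herm V x = (x *m V *m conjtr x) 0 0 + ((x *m V *m conjtr x) 0 0)^*.
Proof.
rewrite /herm mulmxDr mulmxDl mxE; congr (_ + _).
have -> : x *m conjtr V *m conjtr x = conjtr (x *m V *m conjtr x) by rewrite !conjtrM conjtrK mulmxA.
by rewrite !mxE.
Qed.

Lemma herm_congr n (G V : 'M[C]_n) x :
  herm (G *m V *m conjtr G) x = herm V (x *m G).
Proof.
by rewrite /herm !conjtrM conjtrK mulmxDr !mulmxDl !mulmxDr !mulmxDl !mulmxA.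
Qed.

(** On y + i z with real values of V on y and z, the imaginary part of the
sesquilinear form cancels in V + V^*. This is what carries semidefiniteness
from real to complex vectors. *)
Lemma herm_rect n (V : 'M[C]_n) (y z : 'rV[C]_n) (i a b c d : C) :
  i * i = -1 -> i^* = - i ->
  (y *m V *m conjtr y) 0 0 = a -> (z *m V *m conjtr z) 0 0 = b ->
  (z *m V *m conjtr y) 0 0 = c -> (y *m V *m conjtr z) 0 0 = d ->
  a^* = a -> b^* = b -> c^* = c -> d^* = d ->
  herm V (y + i *: z) = 2 * (a + b).
Proof.
move=> ii ic; pose q (u v : 'rV[C]_n) := (u *m V *m conjtr v) 0 0.
rewrite -!/(q _ _) => ea eb ec ed ra rb rc rd; rewrite hermE -/(q _ _).
have addl u v x : q (u + v) x = q u x + q v x by rewrite /q !mulmxDl mxE.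
have addr u v x : q x (u + v) = q x u + q x v by rewrite /q conjtrD mulmxDr mxE.
have scl e u v : q (e *: u) v = e * q u v by rewrite /q -!scalemxAl mxE.
have scr e u v : q u (e *: v) = e^* * q u v by rewrite /q conjtrZ -scalemxAr mxE.
have iK x : i * (- i * x) = x by rewrite mulNr mulrN mulrA ii mulN1r opprK.
have -> : q (y + i *: z) (y + i *: z) = a + b + i * (c - d).
  rewrite addl !addr !scl !scr ea eb ec ed ic iK; ring.
rewrite !(rmorphD, rmorphM, rmorphN) /= ra rb rc rd ic; ring.
Qed.

(** An affine function of t and conj t that is bounded above is constant. The
value t = u h, with u chosen to make the sum 1, gives the contradiction. *)
Lemma herm_line (p h : C) :
  (forall t, p + (t^* * h + t * h^*) <= 0) -> h = 0.
Proof.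
move=> le0; apply/eqP/negPn/negP=> h0.
have p0 : p <= 0 by have := le0 0; rewrite conjC0 !mul0r !addr0.
have hh : h * h^* != 0 by rewrite mulf_neq0 // conjC_eq0.
pose u := (1 - p) / (2 * `|h| ^+ 2); pose t := u * h.
have ru : u^* = u.
  apply/CrealP; rewrite rpredM ?rpredV ?rpredB ?rpred1 ?realE ?p0 ?orbT //.
  by rewrite mulr_ge0 ?exprn_ge0.
have et : t^* * h + t * h^* = 1 - p.
  rewrite /t rmorphM /= ru /u normCK; field.
  by rewrite conjC_eq0 h0.
by have := le0 t; rewrite et addrC subrK ler10.
Qed.

(** On the orthogonal of the isotropic first basis vector, the form does not
depend on the coordinate along that vector. *)
Lemma herm_block m z a b c (d : 'M[C]_m) e x :
  let V : 'M[C]_(1 + (1 + m)) :=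
    block_mx 0 (row_mx z%:M 0) (col_mx 1%:M 0) (block_mx a b c d) in
  herm V (row_mx e (row_mx 0 x)) = herm d x.
Proof.
move=> V; rewrite !hermE.
have -> : row_mx e (row_mx 0 x) *m V *m conjtr (row_mx e (row_mx 0 x)) =
          x *m d *m conjtr x.
  rewrite /V mul_row_block mul_row_col mul_mx_row mul_row_block.
  rewrite add_row_mx !(mul0mx, mulmx0, mul1mx, mulmx1, add0r, addr0).
  by rewrite !conjtr_row_mx !mul_row_col conjtr0 mulmx0 mul0mx !add0r.
by [].
Qed.

(** A shift by the isotropic vector changes the form by a linear term only, whose
coefficient contains 1 + conj z; this factor is not 0 when |z| < 1. *)
Lemma herm_block_line m z a b c (d : 'M[C]_m) (e : 'M[C]_1) t (q : 'rV[C]_(1 + (1 + m))) :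
  let V : 'M[C]_(1 + (1 + m)) :=
    block_mx 0 (row_mx z%:M 0) (col_mx 1%:M 0) (block_mx a b c d) in
  let h := (lsubmx (rsubmx q)) 0 0 * (1 + z^* ) * (e 0 0)^* in
  herm V (q + t *: row_mx e 0) = herm V q + (t^* * h + t * h^* ).
Proof.
move=> V h; rewrite !hermE.
pose w := row_mx e 0 : 'rV_(1 + (1 + m)); pose q1 := lsubmx (rsubmx q).
have eq : q = row_mx (lsubmx q) (row_mx q1 (rsubmx (rsubmx q))) by rewrite !hsubmxK.
have wV : w *m V = row_mx 0 (row_mx (z *: e) 0).
  rewrite /w /V mul_row_block !mul0mx mulmx0 !addr0 mul_mx_row mulmx0.
  by rewrite mul_mx_scalar.
have wq : w *m V *m conjtr q = z *: e *m conjtr q1.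
  by rewrite wV eq !conjtr_row_mx !mul_row_col !mul0mx add0r addr0.
have ww : w *m V *m conjtr w = 0.
  by rewrite wV conjtr_row_mx conjtr0 mul_row_col mul0mx mulmx0 addr0.
have qw : q *m V *m conjtr w = q1 *m conjtr e.
  rewrite -mulmxA -[V *m _]conjtrK conjtrM conjtrK.
  have -> : w *m conjtr V = row_mx 0 (row_mx e 0).
    rewrite /w /V conjtr_block !conjtr_row_mx !conjtr_col_mx !conjtr0 conjtr1.
    by rewrite mul_row_block !mul0mx mulmx0 !addr0 mul_mx_row mulmx0 mulmx1.
  by rewrite eq !conjtr_row_mx !mul_row_col !conjtr0 !mulmx0 add0r addr0.
have -> : (q + t *: w) *m V *m conjtr (q + t *: w) =
   q *m V *m conjtr q + t^* *: (q1 *m conjtr e) + t *: (z *: e *m conjtr q1).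
  rewrite conjtrD conjtrZ !mulmxDl !mulmxDr -!scalemxAl -!scalemxAr ww wq qw.
  by rewrite !scaler0 addr0 -scalemxAl.
rewrite [in RHS]/h -/q1; rewrite !mxE !big_ord1 !mxE.
rewrite !(rmorphD, rmorphM) /= !(rmorph1, conjCK) /=; ring.
Qed.

(** Let W be the row space of K, and v the isotropic first basis vector. If v is
not in W, the vectors of W orthogonal to v inject into the quotient of that
orthogonal by v, and at most one dimension is lost. If v is in W, semidefiniteness
and [herm_line] make all of W orthogonal to v, and only v itself is lost. *)
Lemma deflate_family m k z a b c (d : 'M[C]_m) (K : 'M[C]_(k, 1 + (1 + m))) :
  let V : 'M[C]_(1 + (1 + m)) :=
    block_mx 0 (row_mx z%:M 0) (col_mx 1%:M 0) (block_mx a b c d) in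
  `|z| < 1 -> row_free K -> (forall x, herm V (x *m K) <= 0) ->
  exists k' (K' : 'M[C]_(k', m)),
    [/\ (k <= k'.+1)%N, row_free K' & forall x, herm d (x *m K') <= 0].
Proof.
move=> V z1 fK nK.
(* The row space of N is the image in the quotient of the vectors of W that are
orthogonal to v, those with be-coordinate 0. *)
pose al := lsubmx K; pose be := lsubmx (rsubmx K); pose ka := rsubmx (rsubmx K).
have eK : K = row_mx al (row_mx be ka) by rewrite !hsubmxK.
pose N := kermx be *m ka.
exists (\rank N), (row_base N); split; last first.
- move=> x; have /submxP[y ey] : (x *m row_base N <= N)%MS.
    by rewrite (submx_trans (submxMl _ _)) // eq_row_base.
  have := nK (y *m kermx be).
  rewrite eK !mul_mx_row -[y *m _ *m be]mulmxA mulmx_ker mulmx0 herm_block.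
  by rewrite ey /N mulmxA.
- exact: row_base_free.
have rN := mxrank_mul_ker (kermx be) ka; rewrite -/N mxrank_ker in rN.
have rbe : (\rank be <= 1)%N by apply: rank_leq_col.
have [e0|] := eqVneq (kermx be :&: kermx ka)%MS 0.
  by move: rN; rewrite e0 mxrank0; lia.
case/rowV0Pn=> y; rewrite sub_capmx => /andP[/sub_kermxP yb /sub_kermxP yk] y0.
have yK : y *m K = row_mx (y *m al) 0 by rewrite eK !mul_mx_row yb yk row_mx0.
have a0 : (y *m al) 0 0 != 0.
  apply: contraNneq y0 => e; apply/eqP/(row_free_inj fK).
  rewrite mul0mx yK [y *m al]mx11_scalar e; apply/matrixP=> i j.
  by rewrite !mxE; case: splitP => ? _; rewrite !mxE ?mul0rn.
(* y K is a nonzero multiple of v, so v is in the row space of K. *)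
have be0 : be = 0.
  apply/row_matrixP=> i; rewrite row0; apply/matrixP=> i' j; rewrite !ord1.
  pose q := row i K.
  suff : (lsubmx (rsubmx q)) 0 0 * (1 + z^* ) * ((y *m al) 0 0)^* = 0.
    move/eqP; rewrite !mulf_eq0 conjC_eq0 (negPf a0) orbF => /orP[/eqP|].
      by rewrite !mxE.
    rewrite addr_eq0 => /eqP e; move: z1; rewrite -norm_conjC.
    by rewrite -[z^*]opprK -e normrN normr1 ltxx.
  apply: (@herm_line (herm V q)) => t.
  rewrite -(herm_block_line z a b c d (y *m al) t q) -/V -yK.
  by rewrite /q rowE scalemxAl -mulmxDl.
have fb : row_full (kermx be).
  by rewrite -col_leq_rank mxrank_ker be0 mxrank0 subn0.
rewrite (eqmxMfull _ fb); suff : (\rank K <= (\rank ka).+1)%N by rewrite (eqP fK).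
have -> : K = al *m row_mx 1%:M 0 + ka *m row_mx 0 (row_mx 0 1%:M).
  by rewrite {1}eK be0 !mul_mx_row !mulmx0 !mulmx1 add_row_mx addr0 add0r.
apply: leq_trans (mxrank_add _ _) _; apply: (@leq_add _ _ 1%N).
  exact: leq_trans (mxrankM_maxr _ _) (rank_leq_row _).
exact: mxrankM_maxl.
Qed.

(** V - z V^* is - z times the conjugate transpose of V - w V^*, w = 1 / conj z. *)
Lemma pencil_root_mirror n (V : 'M[C]_n) z : z != 0 ->
  root (pencil V) (z^-1)^* -> root (pencil V) z.
Proof.
move=> z0; rewrite !rootE !horner_pencil => /eqP h.
suff -> : V - z *: conjtr V = (- z) *: conjtr (V - (z^-1)^* *: conjtr V).
  by rewrite detZ det_ct h conjC0 mulr0.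
apply/matrixP=> i j; rewrite !mxE rmorphB rmorphM /= !conjCK mulNr mulrBr mulVKf //.
by rewrite opprB.
Qed.

Lemma pencil_char n (V : 'M[C]_n) : V \in unitmx ->
  exists2 e, e != 0 & pencil V = e *: char_poly (V *m invmx (conjtr V)).
Proof.
move=> uV; have uW : conjtr V \in unitmx by rewrite conjtr_unit.
exists ((-1) ^+ n * \det (conjtr V)).
  by rewrite mulf_neq0 ?signr_eq0 // -unitfE -unitmxE.
have -> : pencil V =
    \det ((-1) *: (char_poly_mx (V *m invmx (conjtr V)) *m map_mx polyC (conjtr V))).
  congr (\det _); rewrite /char_poly_mx mulmxBl -map_mxM mulmxKV //=.
  by rewrite mul_scalar_mx scaleN1r opprB.
rewrite detZ det_mulmx det_map_mx -mul_polyC polyCM rmorphXn rmorphN1 /=.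
by rewrite -mulrA [_%:P * _]mulrC.
Qed.

(** Induction on n, splitting off a zero in the open disc if there is one.
If there is none, the symmetry [pencil_root_mirror] shows that there is none
outside the closed disc either. Then 0 is not a zero, V is invertible, and the
pencil is a multiple of a characteristic polynomial: it has n zeroes, and
2k <= n + n. *)
Theorem unit_circle_roots n k (V : 'M[C]_n) (K : 'M[C]_(k, n)) :
  pencil V != 0 -> row_free K -> (forall x, herm V (x *m K) <= 0) ->
  exists t : seq C, [/\ all (fun z => `|z| == 1) t,
    (2 * k <= n + size t)%N & \prod_(z <- t) ('X - z%:P) %| pencil V].
Proof.
elim/ltn_ind: n k V K => n IH k V K p0 fK nK.
have [rs ers] := closed_field_poly_normal (pencil V).
have rP z : root (pencil V) z = (z \in rs).
  by rewrite ers rootZ ?lead_coef_eq0 // root_prod_XsubC.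
have [/hasP[z zr z1]|/hasPn nr] := boolP (has (fun z => `|z| < 1) rs); last first.
  have uV : V \in unitmx.
    have : 0 \notin rs by apply/negP=> /nr; rewrite normr0 ltr01.
    by rewrite -rP rootE horner_pencil scale0r subr0 unitmxE unitfE.
  exists rs; split.
  - apply/allP=> z zr; have z0 : z != 0.
      by apply: contraTneq zr => ->; apply/negP=> /nr; rewrite normr0 ltr01.
    have /nr : (z^-1)^* \in rs.
      rewrite -rP; apply: pencil_root_mirror; first by rewrite conjC_eq0 invr_eq0.
      by rewrite -fmorphV invrK conjCK rP.
    rewrite norm_conjC normfV invf_lt1 ?normr_gt0 // => z2.
    move: (nr _ zr) z2.
    by case: (real_ltgtP (normr_real z) (@real1 C)).
  - have [e e0 pe] := pencil_char uV.
    have : size (pencil V) = n.+1 by rewrite pe size_scale // size_char_poly.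
    rewrite ers size_scale ?lead_coef_eq0 // size_prod_XsubC => -[->].
    by rewrite -(eqP fK) addnn mul2n leq_double rank_leq_col.
  by rewrite [X in _ %| X]ers dvdpZr ?lead_coef_eq0.
have {zr}rz : root (pencil V) z by rewrite rP.
move: z1 rz {rs ers rP}.
case: n IH V K p0 fK nK => [|[|m]] IH V K p0 fK nK z1 rz.
- by move: rz; rewrite rootE horner_pencil det_mx00 oner_eq0.
- move: rz; rewrite rootE horner_pencil det_mx11 !mxE subr_eq0 => /eqP e.
  have /(contract_norm z1) e0 : ((V 0 0)^* )^* = z * (V 0 0)^* by rewrite conjCK.
  have v0 : V 0 0 = 0 by rewrite e e0 mulr0.
  by case/eqP: p0; rewrite /pencil det_mx11 !mxE v0 conjC0 mulr0 subr0.
have [G uG [W eW]] := deflation (V := V) z1 p0 rz.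
rewrite -[W]submxK in eW.
have iG : K *m invmx G *m G = K by rewrite mulmxKV.
have fK' : row_free (K *m invmx G).
  by rewrite -row_leq_rank mxrankMfree ?row_leq_rank // row_free_unit unitmx_inv.
have nK' x : herm (G *m V *m conjtr G) (x *m (K *m invmx G)) <= 0.
  by rewrite herm_congr -mulmxA iG.
rewrite eW in nK'.
have [k' [K' [kk' fK2 nK2]]] := deflate_family z1 fK' nK'.
have [e e0 pe] := pencil_block z (ulsubmx W) (ursubmx W) (dlsubmx W) (drsubmx W).
rewrite -eW pencil_congr in pe.
have g0 : \det G * (\det G)^* != 0.
  by rewrite mulf_neq0 ?conjC_eq0 // -unitfE -unitmxE.
have pd0 : pencil (drsubmx W) != 0.
  by apply: contraNneq p0 => h; move/eqP: pe; rewrite h mulr0 mulf_eq0 polyC_eq0 (negPf g0).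
have [|t [t1 kt pt]] := IH m _ k' _ K' pd0 fK2 nK2; first by [].
exists t; split => //.
  apply: leq_trans (leq_mul (leqnn 2) kk') _.
  by rewrite mulnS -[m.+2]add2n -addnA leq_add2l.
rewrite -(dvdpZr _ _ g0) -mul_polyC pe.
exact: dvdp_mull.
Qed.

End UnitCircle.

Section Zeroes.
Variable C : numClosedFieldType.

Lemma size_pencil n (V : 'M[C]_n) : (size (pencil V) <= n.+1)%N.
Proof.
apply: leq_trans (size_sum _ _ _) _; apply/bigmax_leqP => s _.
have -> : (-1) ^+ perm.odd_perm s = ((-1) ^+ perm.odd_perm s)%:P :> {poly C} by rewrite rmorphXn rmorphN1.
rewrite mul_polyC; apply: leq_trans (size_scale_leq _ _) _.
apply: leq_trans (size_poly_prod_leq _ _) _; rewrite card_ord leq_subLR.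
rewrite addnS ltnS addnn -mul2n mulnC -[X in (_ <= X * _)%N]card_ord -sum_nat_const.
apply: leq_sum => i _; rewrite !mxE; apply: leq_trans (size_polyD _ _) _.
rewrite geq_max size_polyN (leq_trans (size_polyC_leq1 _)) //=.
by rewrite mulrC mul_polyC (leq_trans (size_scale_leq _ _)) ?size_polyX.
Qed.

(** A unit root is not 0, hence the power of X cannot account for it. *)
Lemma unit_circle_count (t s : seq C) q :
  all (fun z => `|z| == 1) t ->
  \prod_(z <- t) ('X - z%:P) %| 'X^q * \prod_(z <- s) ('X - z%:P) ->
  (size t <= count (fun z : C => (`|z| == 1)%R) s)%N.
Proof.
elim: t s => //= z t IH s /andP[z1 t1]; rewrite big_cons => h.
have z0 : z != 0 by apply: contraTneq z1 => ->; rewrite normr0 eq_sym oner_eq0.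
have zs : z \in s.
  have : root ('X^q * \prod_(z <- s) ('X - z%:P)) z.
    by rewrite -dvdp_XsubCl; apply: dvdp_trans h; apply: dvdp_mulr.
  rewrite rootM root_prod_XsubC => /orP[|//].
  by rewrite rootE hornerXn expf_eq0 (negPf z0) andbF.
have ps := perm_to_rem zs.
rewrite (permP ps) /= z1 add1n ltnS; apply: IH => //.
move: h; rewrite (perm_big _ ps) big_cons mulrCA dvdp_mul2l //.
by rewrite polyXsubC_eq0.
Qed.

Lemma roots_dvdp (s : seq C) (p : {poly C}) b : 0 \notin s ->
  \prod_(z <- s) ('X - z%:P) %| 'X^b * p -> \prod_(z <- s) ('X - z%:P) %| p.
Proof.
move=> s0; rewrite Gauss_dvdpr //; apply: coprimep_expr.
by rewrite coprimepX root_prod_XsubC.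
Qed.

End Zeroes.

(** * The quadratic form of a word and its families of nonnegative weights *)

Definition column_sum (V : zmodType) j (s : seq (nat * V)) : V :=
  \sum_(p <- s | p.1 == j) p.2.

Lemma column_sum_cons (V : zmodType) j (p : nat * V) s :
  column_sum j (p :: s) = (if p.1 == j then p.2 else 0) + column_sum j s.
Proof. by rewrite /column_sum big_cons; case: ifP; rewrite ?add0r. Qed.

Lemma column_sum_cat (V : zmodType) j (s t : seq (nat * V)) :
  column_sum j (s ++ t) = column_sum j s + column_sum j t.
Proof. by rewrite /column_sum big_cat. Qed.

Lemma column_sum_absent (V : zmodType) j (s : seq (nat * V)) :
  j \notin unzip1 s -> column_sum j s = 0.
Proof.
move=> js; rewrite /column_sum big1_seq // => p /andP[/eqP e ps].
by case/negP: js; rewrite -e map_f.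
Qed.

Section WordForm.
Variable R : comPzRingType.
Implicit Types s t : seq (nat * R).

(** A word is the sequence of the columns of its letters; here each letter also
carries a weight. On weights with zero column sums this is -2 times the linking
form of the surface, and its invariance under rotation relies on these sums. *)
Fixpoint word_form s : R :=
  if s is p :: t then p.2 ^+ 2 + 2 * (p.2 * column_sum p.1.+1 t) + word_form t
  else 0.

Definition cross s t : R := \sum_(p <- s) p.2 * column_sum p.1.+1 t.

Lemma word_form_cat s t :
  word_form (s ++ t) = word_form s + word_form t + 2 * cross s t.
Proof.
elim: s => [|p s IH] /=; first by rewrite /cross big_nil mulr0 addr0 add0r.
rewrite IH column_sum_cat /cross big_cons; ring.
Qed.

Lemma word_form_context P s t :
  (forall j, column_sum j s = column_sum j t) -> word_form s = word_form t ->
  word_form (P ++ s) = word_form (P ++ t).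
Proof.
move=> est eq; rewrite !word_form_cat eq; congr (_ + 2 * _).
by apply: eq_bigr => p _; rewrite est.
Qed.

(** The moved letter was paired with the column to its right, and becomes paired
with the column to its left; both column sums vanish. *)
Lemma word_form_rot1 p s : (forall j, column_sum j (p :: s) = 0) ->
  word_form (s ++ [:: p]) = word_form (p :: s).
Proof.
move=> s0; rewrite word_form_cat /=.
have h j : p.1 != j -> column_sum j s = 0.
  by move=> pj; rewrite -(s0 j) column_sum_cons (negPf pj) add0r.
rewrite (h p.1.+1) ?neq_ltn ?leqnn // /column_sum big_nil.
have -> : cross s [:: p] = \sum_(q <- s | q.1.+1 == p.1) q.2 * p.2.
  rewrite /cross [RHS]big_mkcond; apply: eq_bigr => q _.
  by rewrite /column_sum big_cons big_nil eq_sym; case: eqP; rewrite ?addr0 ?mulr0.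
have -> : \sum_(q <- s | q.1.+1 == p.1) q.2 * p.2 = 0.
  case e : p.1 => [|k]; first by rewrite big_pred0.
  under eq_bigl do rewrite eqSS.
  by rewrite -mulr_suml [X in X * _](h k) ?mul0r // e neq_ltn leqnn orbT.
ring.
Qed.

Lemma word_form_commute i x s t : i.+1 \notin unzip1 s ->
  (forall j, j \in unzip1 s -> j.+1 != i) ->
  word_form ((i, x) :: s ++ t) = word_form (s ++ (i, x) :: t).
Proof.
move=> i1 i2; rewrite [LHS]/= column_sum_cat (column_sum_absent i1) !word_form_cat /=.
have -> : cross s ((i, x) :: t) = cross s t.
  rewrite /cross !big_seq; apply: eq_bigr => p ps; rewrite column_sum_cons /=.
  by rewrite eq_sym (negPf (i2 _ (map_f _ ps))) add0r.
rewrite add0r; ring.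
Qed.

(** The substitution (a, b, c) -> (c, a + c, b - c) keeps the column sums, so the
rest of the word sees no difference, and keeps the form of the three letters. *)
Lemma word_form_braid i a b c t :
  word_form [:: (i, a), (i.+1, b), (i, c) & t] =
  word_form [:: (i.+1, c), (i, a + c), (i.+1, b - c) & t].
Proof.
rewrite /= !column_sum_cons /= !eqxx.
have e1 : (i == i.+1) = false by rewrite ltn_eqF.
have e2 : (i.+1 == i.+2) = false by rewrite ltn_eqF.
have e3 : (i == i.+2) = false by rewrite ltn_eqF.
rewrite e1 e2 e3 !add0r; ring.
Qed.

End WordForm.

Lemma column_sum_braid (V : zmodType) i (a b c : V) t j :
  column_sum j [:: (i, a), (i.+1, b), (i, c) & t] =
  column_sum j [:: (i.+1, c), (i, a + c), (i.+1, b - c) & t].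
Proof.
rewrite !column_sum_cons /= !addrA; congr (_ + _).
have [->|ij] := eqVneq i j; first by rewrite gtn_eqF // addr0 add0r addr0.
case: eqP => _; by rewrite !(add0r, addr0) // addrC subrK.
Qed.

Section Families.
Variable R : realFieldType.

(** A family of weights with parameters c in R^I is stored as one word, in which
each letter carries its weight as a linear form in c with integral
coefficients. Integrality is what makes the family consist of cycles that are
combinations of a basis of the integral homology. *)
Definition lin_eval (I : finType) (c : I -> R) (a : {ffun I -> int}) : R :=
  \sum_i c i * (a i)%:~R.

Lemma lin_evalD (I : finType) (c : I -> R) a b : lin_eval c (a + b) = lin_eval c a + lin_eval c b.
Proof.
by rewrite /lin_eval -big_split; apply: eq_bigr => i _; rewrite ffunE rmorphD mulrDr.
Qed.

Lemma lin_evalN (I : finType) (c : I -> R) a : lin_eval c (- a) = - lin_eval c a.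
Proof.
by rewrite /lin_eval -sumrN; apply: eq_bigr => i _; rewrite ffunE rmorphN mulrN.
Qed.

Lemma lin_eval0 (I : finType) (c : I -> R) : lin_eval c 0 = 0.
Proof. by rewrite /lin_eval big1 // => i _; rewrite ffunE mulr0. Qed.

Definition eval_word (I : finType) (c : I -> R) (s : seq (nat * {ffun I -> int})) :=
  [seq (p.1, lin_eval c p.2) | p <- s].

Lemma column_sum_eval (I : finType) (c : I -> R) j s : column_sum j (eval_word c s) = lin_eval c (column_sum j s).
Proof.
elim: s => [|p s IH]; first by rewrite /column_sum !big_nil lin_eval0.
by rewrite /= !column_sum_cons IH lin_evalD /=; case: ifP; rewrite ?lin_eval0.
Qed.

Lemma unzip1_eval (I : finType) (c : I -> R) s : unzip1 (eval_word c s) = unzip1 s.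
Proof. by rewrite /eval_word /unzip1 -map_comp. Qed.

(** The parameters in B are free and the others are 0. By the last condition the
weights determine the parameters, so that the family has dimension #|B|. *)
Definition nonneg_family (I : finType) (B : {set I})
    (s : seq (nat * {ffun I -> int})) : Prop :=
  [/\ forall j, column_sum j s = 0,
      forall c : I -> R, (forall i, i \notin B -> c i = 0) ->
        0 <= word_form (eval_word c s) &
      forall c : I -> R, (forall i, i \notin B -> c i = 0) ->
        (forall p, p \in s -> lin_eval c p.2 = 0) -> forall i, c i = 0].

Definition nonneg_index (w : seq nat) k : Prop :=
  exists (I : finType) (B : {set I}) (s : seq (nat * {ffun I -> int})),
    [/\ #|B| = k, unzip1 s = w & nonneg_family B s].

Lemma unzip1_cat (V : Type) (s : seq (nat * V)) u v : unzip1 s = u ++ v ->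
  exists s1 s2, [/\ s = s1 ++ s2, unzip1 s1 = u & unzip1 s2 = v].
Proof.
move=> e; exists (take (size u) s), (drop (size u) s); rewrite cat_take_drop.
by rewrite /unzip1 map_take map_drop -/(unzip1 s) e take_size_cat // drop_size_cat.
Qed.

(** The new letter receives weight 0. *)
Lemma nonneg_index_insert u i v k :
  nonneg_index (u ++ v) k -> nonneg_index (u ++ i :: v) k.
Proof.
move=> [I [B [s [kB ws [s0 sQ sI]]]]].
have [s1 [s2 [es <- <-]]] := unzip1_cat ws; subst s.
exists I, B, (s1 ++ (i, 0) :: s2); split => //; first by rewrite /unzip1 map_cat.
split=> [j|c cB|c cB s_0].
- by rewrite column_sum_cat column_sum_cons /= if_same add0r -column_sum_cat.
- have := sQ c cB; rewrite /eval_word !map_cat; congr (0 <= _).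
  apply: word_form_context => [j|]; rewrite /= ?column_sum_cons /= lin_eval0 ?if_same ?add0r //.
  by rewrite mul0r expr0n /= mulr0 add0r add0r.
apply: sI => // p ps; apply: s_0; move: ps; rewrite !mem_cat inE.
by case/orP=> ->; rewrite ?orbT.
Qed.

Lemma nonneg_index_catC u v k :
  nonneg_index (u ++ v) k -> nonneg_index (v ++ u) k.
Proof.
elim: u v => [|i u IH] v; first by rewrite cats0.
move=> [I [B [[|p s] [kB //= [pi us] [s0 sQ sI]]]]].
rewrite -cat_rcons -cats1; apply: IH.
exists I, B, (s ++ [:: p]); split => //.
  by rewrite /unzip1 map_cat /= -/(unzip1 s) us pi catA.
split=> [j|c cB|c cB s_0].
- by rewrite -(s0 j) !column_sum_cat !column_sum_cons /column_sum big_nil addr0 addrC.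
- have := sQ c cB; congr (0 <= _); rewrite [in RHS]/eval_word map_cat.
  symmetry; apply: (@word_form_rot1 _ (p.1, lin_eval c p.2)) => j.
  by rewrite -[_ :: _]/(eval_word c (p :: s)) column_sum_eval s0 lin_eval0.
apply: sI => // q qs; apply: s_0.
by rewrite mem_cat inE orbC -in_cons.
Qed.

(** The first letter i commutes with u and the second one with v, so both can be
moved next to the letter i + 1, where [word_form_braid] applies. The weights
(q - p, r + p, p) are the preimage of (p, q, r) under its substitution. *)
Lemma nonneg_index_braid i u v t k :
  {in u ++ v, forall j, [&& j != i, j.+1 != i & j != i.+1]} ->
  nonneg_index (u ++ [:: i.+1, i, i.+1 & v ++ t]) k ->
  nonneg_index (i :: u ++ i.+1 :: v ++ i :: t) k.
Proof.
move=> uv [I [B [s [kB ws [s0 sQ sI]]]]].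
have [su [s' [es eu es']]] := unzip1_cat ws.
case: s' es' es => [//|[? p] [//|[? q] [//|[? r] s']]] /= [-> -> ->].
case/unzip1_cat => sv [st [-> ev' et]] es.
rewrite -eu -ev' -et in uv *.
exists I, B, ((i, q - p) :: su ++ (i.+1, r + p) :: sv ++ (i, p) :: st); split => //.
  by rewrite /= /unzip1 map_cat /= map_cat.
have iu : i.+1 \notin unzip1 su.
  apply/negP=> h; have := uv i.+1.
  by rewrite mem_cat h ?orbT eqxx !andbF => /(_ isT).
have iv : i.+1 \notin unzip1 sv.
  apply/negP=> h; have := uv i.+1.
  by rewrite mem_cat h ?orbT eqxx !andbF => /(_ isT).
have ju j : j \in unzip1 su -> j.+1 != i.
  by move=> h; have := uv j; rewrite mem_cat h => /(_ isT) /and3P[].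
have jv j : j \in unzip1 sv -> j.+1 != i.
  by move=> h; have := uv j; rewrite mem_cat h orbT => /(_ isT) /and3P[].
split=> [j|c cB|c cB s_0].
- rewrite -(s0 j) es !(column_sum_cons, column_sum_cat) /=.
  have [->|ij] := eqVneq i j; first rewrite gtn_eqF //; last case: eqP => _;
    by apply/ffunP=> x; rewrite !ffunE; ring.
- have := sQ c cB; rewrite es.
  have -> : eval_word c (su ++ [:: (i.+1, p), (i, q), (i.+1, r) & sv ++ st]) =
     eval_word c su ++ [:: (i.+1, lin_eval c p), (i, lin_eval c q), (i.+1, lin_eval c r) & eval_word c sv ++ eval_word c st].
    by rewrite /eval_word map_cat /= map_cat.
  have -> : eval_word c ((i, q - p) :: su ++ (i.+1, r + p) :: sv ++ (i, p) :: st) =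
     (i, lin_eval c q - lin_eval c p) :: eval_word c su ++ (i.+1, lin_eval c r + lin_eval c p) :: eval_word c sv ++
     (i, lin_eval c p) :: eval_word c st.
    by rewrite /eval_word /= map_cat /= map_cat /= !lin_evalD lin_evalN.
  rewrite word_form_commute ?unzip1_eval //.
  congr (0 <= _); apply: word_form_context => [j|].
    have := column_sum_braid i (lin_eval c q - lin_eval c p) (lin_eval c r + lin_eval c p) (lin_eval c p).
    move/(_ (eval_word c sv ++ eval_word c st) j); rewrite subrK addrK => <-.
    by rewrite !(column_sum_cons, column_sum_cat) /=; congr (_ + (_ + _)); rewrite addrCA.
  have := word_form_braid i (lin_eval c q - lin_eval c p) (lin_eval c r + lin_eval c p) (lin_eval c p).
  move/(_ (eval_word c sv ++ eval_word c st)); rewrite subrK addrK => <-.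
  apply: (@word_form_context _ [:: _; _]) => [j|].
    by rewrite !(column_sum_cons, column_sum_cat) /= addrCA.
  by rewrite -word_form_commute ?unzip1_eval.
apply: sI => // x; rewrite es.
have p_0 : lin_eval c p = 0 by apply: (s_0 (i, p)); rewrite !(inE, mem_cat) eqxx !orbT.
have q_0 : lin_eval c q = 0.
  have := s_0 (i, q - p); rewrite !(inE, mem_cat) eqxx => /(_ isT) /=.
  by rewrite lin_evalD lin_evalN p_0 subr0.
have r_0 : lin_eval c r = 0.
  have := s_0 (i.+1, r + p); rewrite !(inE, mem_cat) eqxx !orbT => /(_ isT) /=.
  by rewrite lin_evalD p_0 addr0.
rewrite !(inE, mem_cat) => /or4P[xs|/eqP->|/eqP->|/orP[/eqP->|/orP[xs|xs]]] //;
  by apply: s_0; rewrite !(inE, mem_cat) xs !orbT.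
Qed.
End Families.

(** * Labels on a cycle of degrees *)

Section Labels.
Local Open Scope nat_scope.

(** The marks A, B and x, in this order, each present or not. Later a selection
consists of the regions that carry a given mark. *)
Definition label := (bool * bool * bool)%type.

Definition blank : label := (false, false, false).

(** The condition of [selection_bound] below, for each of the marks of p, on a
region of degree d between the labels q and n. *)
Definition admissible (q : label) (d : nat) (p n : label) : bool :=
  [&& p.1.1 ==> (d <= ~~ q.1.1 + ~~ n.1.1),
      p.1.2 ==> (d <= ~~ q.1.2 + ~~ n.1.2) &
      p.2 ==> (d <= ~~ q.2 + ~~ n.2)].

(** The mark x counts twice on a region of degree 0, because such a region can be
selected for both colors at once. *)
Definition weight d (p : label) : nat :=
  p.1.1 + p.1.2 + (if d == 0 then p.2.*2 else p.2).

(** A mark x is not allowed on a region of degree 2; see [selected_horizontal]. *)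
Definition fits d (p : label) : bool :=
  (weight d p == 3 - d) && (p.2 ==> (d < 2)).

Definition avoids (f n : label) : bool :=
  ~~ [|| f.1.1 && n.1.1, f.1.2 && n.1.2 | f.2 && n.2].

(** The marks of p that the next region must not carry, since the previous label q
does not by itself meet the degree d. *)
Definition pending (q : label) d (p : label) : label :=
  (p.1.1 && (~~ q.1.1 < d), p.1.2 && (~~ q.1.2 < d), p.2 && (~~ q.2 < d)).

Definition labels : seq label :=
  [seq (ab, x) | ab <- [seq (a, b) | a <- [:: true; false], b <- [:: true; false]],
                 x <- [:: true; false]].

(** Regions of degrees ds can be labelled one after the other, when q is the label
just before them and the first of them must avoid the marks f. The sequence ends
at a blank region, whence the test against blank. *)
Fixpoint solvable (q f : label) (ds : seq nat) : bool :=
  if ds is d :: ds' then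
    has (fun p => [&& fits d p, avoids f p, admissible q d p blank &
                   solvable p (pending q d p) ds']) labels
  else true.

(** In the labels with a boolean c, true stands for A and false for B. *)
Definition color c : label := (c, ~~ c, false).
Definition color_x c : label := (c, ~~ c, true).
Definition colors : label := (true, true, false).
Definition only_x : label := (false, false, true).

(** Backwards induction on the sequence; the three clauses are what the induction
needs. A region of degree 0, 1 or 2 takes one of A and B together with x, two
marks, or one of A and B; a larger degree takes the blank label, after which
anything is possible. On a run of regions of degree 1 the labels are pairs of
marks, and two successive different pairs share one mark, which the next region
then has to avoid. Up to an exchange of A and B, for which pa, px and qa require
both values of c, the last label contains x and shares its color, or contains x
and shares it, or is {A, B}. Each of these states may be a dead end, but at most
one of them is, whatever comes next. *)
Lemma solvableP ds :
  [/\ solvable blank blank ds,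
      forall c, solvable (color c) (color c) ds /\ solvable (color_x c) blank ds &
      let pa := solvable (color_x true) (color true) ds && solvable (color_x false) (color false) ds in
      let px := solvable (color_x true) only_x ds && solvable (color_x false) only_x ds in
      let qa := solvable colors (color true) ds && solvable colors (color false) ds in
      [&& pa || px, px || qa & qa || pa]].
Proof.
elim: ds => [|d ds [E0 EA EP]]; first by split => // - [].
have [A1 B1] := EA true; have [A0 B0] := EA false; move: EP E0 A1 B1 A0 B0.
rewrite /color /color_x /colors /only_x /blank {EA} => EP E0 A1 B1 A0 B0.
(* Degrees from 3 on behave alike. In each case the computation reduces the goal
to a boolean combination of the induction hypotheses. *)
by split; [|case|]; case: d => [|[|[|d]]];
   rewrite /= /fits /weight /admissible /avoids /pending /=
     ?E0 ?A1 ?B1 ?A0 ?B0 /=; move: EP => /=;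
   repeat match goal with |- context [solvable ?p ?f ?s] =>
     case: (solvable p f s) => //= end.
Qed.

Lemma pendingP q d p n : admissible q d p blank -> avoids (pending q d p) n ->
  admissible q d p n.
Proof.
case: q p n => [[? ?] ?] [[[] []] []] [[[] []] []];
  rewrite /admissible /avoids /pending /=; lia.
Qed.

Lemma solvable_labels q f ds : solvable q f ds -> exists ls : seq label,
  [/\ size ls = size ds, avoids f (head blank ls) &
   forall j, j < size ds ->
     fits (nth 0 ds j) (nth blank ls j) &&
     admissible (nth blank (q :: ls) j) (nth 0 ds j) (nth blank ls j)
       (nth blank ls j.+1)].
Proof.
elim: ds q f => [|d ds IH] q f.
  by move=> _; exists [::]; split=> //; case: f => [[? ?] ?]; rewrite /avoids /= !andbF.
move=> /hasP[p _ /and4P[fp ap adm /IH[ls [sz hd hls]]]].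
exists (p :: ls); split; rewrite /= ?sz //.
case=> [_|j /hls //]; rewrite fp /=; apply: pendingP => //.
Qed.

(** Cutting the cycle at z, which is left blank, turns it into a sequence that
starts after a blank label and ends before one. *)
Lemma cycle_labels (T : eqType) (c : seq T) (z : T) (d : T -> nat) :
  uniq c -> z \in c -> exists2 lab : T -> label, lab z = blank &
  forall v, v \in c -> v != z ->
    fits (d v) (lab v) &&
    admissible (lab (prev c v)) (d v) (lab v) (lab (next c v)).
Proof.
move=> uc /rot_to[i s es].
have us : uniq (z :: s) by rewrite -es rot_uniq.
have [sol _ _] := solvableP (map d s).
have [ls [sz _ hls]] := solvable_labels sol; rewrite size_map in sz hls.
exists (fun v => nth blank (blank :: ls) (index v (z :: s))); first by rewrite /= eqxx.
move=> v vc vz; rewrite -(next_rot i uc) -(prev_rot i uc) es.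
have vs : v \in s.
  by have := vc; rewrite -(mem_rot i) es inE (negPf vz).
have vzs : v \in z :: s by rewrite inE vs orbT.
have iv : index v (z :: s) = (index v s).+1 by rewrite /= eq_sym (negPf vz).
have js : index v s < size s by rewrite index_mem.
have := hls _ js; rewrite (nth_map z) // nth_index // prev_nth next_nth vzs iv.
have -> : index (nth z (z :: s) (index v s)) (z :: s) = index v s.
  by rewrite index_uniq //= ltnW.
have -> // : nth blank (blank :: ls) (index (nth z s (index v s).+1) (z :: s)) =
  nth blank ls (index v s).+1.
have [h|h] := ltnP (index v s).+1 (size s).
  by rewrite -[nth z s _]/(nth z (z :: s) (index v s).+2) index_uniq.
by rewrite (nth_default z h) [RHS]nth_default ?sz //= eqxx.
Qed.

End Labels.

(** * Regions and completion of squares *)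

Lemma word_form_sum (R : comPzRingType) (N : nat) (col : 'I_N -> nat) (x : 'I_N -> R) :
  word_form [seq (col k, x k) | k <- enum 'I_N] =
  \sum_k x k ^+ 2 +
  2 * \sum_(l : 'I_N) \sum_(k : 'I_N | (l < k)%N && (col k == (col l).+1)) x l * x k.
Proof.
have srt : sorted (fun i j : 'I_N => (i < j)%N) (enum 'I_N).
  by have := iota_ltn_sorted 0 N; rewrite -val_enum_ord sorted_map.
rewrite -!big_enum /=.
have -> : \sum_(l <- enum 'I_N) \sum_(k : 'I_N | (l < k)%N && (col k == (col l).+1)) x l * x k =
  \sum_(l <- enum 'I_N) \sum_(k <- enum 'I_N | (l < k)%N && (col k == (col l).+1)) x l * x k.
  by apply: eq_bigr => l _; rewrite big_enum_cond.
elim: (enum 'I_N) srt => [|a s IH] /=; first by rewrite !big_nil mulr0 addr0.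
move=> pa; rewrite IH ?(path_sorted pa) // !big_cons ltnn /=.
have tr : transitive (fun i j : 'I_N => (i < j)%N) by move=> ? ? ?; apply: ltn_trans.
have /allP as_ := order_path_min tr pa.
have -> : \sum_(j <- s) \sum_(k <- (a :: s) | (j < k)%N && (col k == (col j).+1)) x j * x k =
  \sum_(j <- s) \sum_(k <- s | (j < k)%N && (col k == (col j).+1)) x j * x k.
  by apply: eq_big_seq => j /as_ aj; rewrite big_cons ltnNge (ltnW aj).
have -> : x a * column_sum (col a).+1 [seq (col k, x k) | k <- s] =
  \sum_(k <- s | (a < k)%N && (col k == (col a).+1)) x a * x k.
  rewrite /column_sum big_map /= mulr_sumr big_seq_cond [RHS]big_seq_cond.
  apply: eq_bigl => k /=; case: (boolP (k \in s)) => //= /as_ ->.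
  by [].
ring.
Qed.

Section Regions.
Variables (N : nat) (col : 'I_N -> nat).
Implicit Types k l v : 'I_N.

Definition column j : seq 'I_N := [seq k <- enum 'I_N | col k == j].

Lemma mem_column j k : (k \in column j) = (col k == j).
Proof. by rewrite mem_filter mem_enum andbT. Qed.

Lemma column_uniq j : uniq (column j).
Proof. by rewrite filter_uniq ?enum_uniq. Qed.

Lemma column_sorted j : sorted (fun k l : 'I_N => (k < l)%N) (column j).
Proof.
apply: sorted_filter; first by move=> ? ? ?; apply: ltn_trans.
by have := iota_ltn_sorted 0 N; rewrite -val_enum_ord sorted_map.
Qed.

(** Columns are read cyclically, as on the closed braid. The region between a
letter k and the next letter of its column is represented by k itself. *)
Definition before k := prev (column (col k)) k.
Definition after k := next (column (col k)) k.

Lemma col_before k : col (before k) = col k.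
Proof. by apply/eqP; rewrite -mem_column mem_prev mem_column. Qed.

Lemma col_after k : col (after k) = col k.
Proof. by apply/eqP; rewrite -mem_column mem_next mem_column. Qed.

Lemma beforeK : cancel before after.
Proof. by move=> k; rewrite /after col_before next_prev ?column_uniq. Qed.

Lemma afterK : cancel after before.
Proof. by move=> k; rewrite /before col_after prev_next ?column_uniq. Qed.

(** The region of column j that contains the letter k of another column starts
at the last letter of column j before k or, if there is none, at the last letter
of the whole column. The value k marks an empty column. *)
Definition region j k : 'I_N :=
  last (last k (column j)) [seq l : 'I_N <- column j | (l < k)%N].

Definition left_region k := if col k is j.+1 then region j k else k.
Definition right_region k := region (col k).+1 k.

Lemma mem_last_filter (T : eqType) (z : T) s (P : pred T) :
  z \in s -> last z (filter P s) \in s.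
Proof.
move=> zs; have := mem_last z (filter P s); rewrite inE => /orP[/eqP->//|].
by rewrite mem_filter => /andP[].
Qed.

Lemma region_col j k : column j != [::] -> col (region j k) = j.
Proof.
move=> cj; apply/eqP; rewrite -mem_column; apply: mem_last_filter.
by case: (column j) cj => //= a s _; rewrite mem_last.
Qed.

Lemma region_absent j k : column j = [::] -> region j k = k.
Proof. by rewrite /region => ->. Qed.

(** The sum telescopes along the cycle, starting from its last element. *)
Lemma sum_prev (V : zmodType) (T : eqType) (f : T -> V) (c : seq T) z m :
  uniq c ->
  \sum_(l <- take m c) (f l - f (prev c l)) =
  f (last (last z c) (take m c)) - f (last z c).
Proof.
move=> uc; elim: m => [|m IH]; first by rewrite take0 big_nil /= subrr.
have [h|h] := leqP (size c) m.
  by rewrite take_oversize ?(leqW h) // -{1}(take_oversize h) IH take_oversize.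
rewrite (take_nth z) // big_rcons /= last_rcons IH.
suff -> : prev c (nth z c m) = last (last z c) (take m c) by rewrite addrC subrKA.
rewrite prev_nth mem_nth //; case: c uc h {IH} => // a s /= /andP[as_ us] h.
case: m h => [|m] h /=; first by rewrite memNindex ?nth_last // nth_last.
rewrite ltnS in h; rewrite index_uniq // (last_nth a) size_takel ?(ltnW h) //.
by case: m h => //= m h; rewrite nth_take.
Qed.

Lemma filter_lt_take (s : seq 'I_N) k : sorted (fun k l : 'I_N => (k < l)%N) s ->
  [seq l : 'I_N <- s | (l < k)%N] = take (size [seq l : 'I_N <- s | (l < k)%N]) s.
Proof.
elim: s => //= a s IH pa; have tr : transitive (fun i j : 'I_N => (i < j)%N) by move=> ? ? ?; apply: ltn_trans.
case: ltnP => ak /=; first by rewrite -IH // (path_sorted pa).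
rewrite (_ : filter _ s = [::]) //; apply/eqP; rewrite -size_eq0 size_filter -leqn0 leqNgt -has_count.
apply/hasPn=> l /(allP (order_path_min tr pa)) al; rewrite -leqNgt.
exact: leq_trans ak (ltnW al).
Qed.

(** The weights f l - f (before l) of column j that precede k add up to the value
of f at the region of k, up to a constant of the column: this is how the form
sees only regions. *)
Lemma sum_column_lt (V : zmodType) (f : 'I_N -> V) j k :
  \sum_(l : 'I_N | (col l == j) && (l < k)%N) (f l - f (before l)) =
  f (region j k) - f (last k (column j)).
Proof.
rewrite /region (filter_lt_take k (column_sorted j)) -sum_prev ?column_uniq //.
rewrite -(filter_lt_take k (column_sorted j)) big_filter {2}/column.
rewrite big_filter_cond big_enum_cond /=.
by apply: eq_bigr => l; rewrite /before => /andP[/eqP -> _].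
Qed.

End Regions.

Section FormBound.
Variables (R : realFieldType) (N : nat) (col : 'I_N -> nat) (p : bool).
Variables (x f : 'I_N -> R).
(* The columns of parity p carry differences of f, the others free weights. *)
Let even k := odd (col k) == p.
Hypothesis hx : forall k, even k -> x k = f k - f (before col k).
Hypothesis hf : forall k, ~~ even k -> f k = 0.
Hypothesis hs : forall j, \sum_(k | col k == j) x k = 0.

Let evenS k l : col k == (col l).+1 -> even k = ~~ even l.
Proof. by rewrite /even => /eqP ->; case: p; rewrite /= ?eqbF_neg ?eqb_id ?negbK. Qed.

Lemma sum_column_const (g : nat -> R) : \sum_(k | ~~ even k) x k * g (col k) = 0.
Proof.
pose M := (\max_k col k).+1.
have cM k : (col k < M)%N by rewrite ltnS leq_bigmax.
rewrite (partition_big (fun k => Ordinal (cM k)) predT) //= big1 // => j _.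
have [ej|ej] := boolP (odd j == p).
  rewrite big1 // => k /andP[]; rewrite /even -val_eqE /= => h /eqP e.
  by rewrite e ej in h.
rewrite (eq_bigl (fun k => col k == j)) => [|k]; last first.
  by rewrite -val_eqE /= /even; case: (col k =P j :> nat) => [->|_]; rewrite ?ej ?andbF.
rewrite (eq_bigr (fun k => x k * g j)) => [|k /eqP -> //].
by rewrite -mulr_suml hs mul0r.
Qed.

Let base j : R := if column col j is h :: t then f (last h t) else 0.

Lemma sum_side j k : ~~ even k -> (odd j == p) ->
  \sum_(l | (col l == j) && (l < k)%N) x l = f (region col j k) - base j.
Proof.
move=> ek ej; transitivity (\sum_(l : 'I_N | (col l == j) && (l < k)%N)
   (f l - f (before col l))).
  by apply: eq_bigr => l /andP[/eqP e _]; rewrite hx // /even e.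
rewrite sum_column_lt /base; congr (_ - _).
by case: (column col j) => //=; rewrite hf.
Qed.

Lemma sum_gt k j : col k != j ->
  \sum_(l | (col l == j) && (k < l)%N) x l = - \sum_(l | (col l == j) && (l < k)%N) x l.
Proof.
move=> kj; apply/eqP; rewrite -addr_eq0 addrC; apply/eqP.
rewrite -[RHS](hs j) [RHS](bigID (fun l : 'I_N => (l < k)%N)) /=.
congr (_ + _); apply: eq_bigl => l; rewrite -leqNgt.
case: (col l =P j) => //= e; rewrite [RHS]leq_eqVlt.
by case: (nat_of_ord k =P l) => //= /val_inj kl; rewrite kl e eqxx in kj.
Qed.

(** A letter k of a column of the other parity is paired with the letters of the
left column before it and with those of the right column after it. By telescoping
these contribute f(left region) - f(right region) =: h k, up to constants that
disappear because the column of k has sum zero. Then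
x^2 + 2 x h >= - h^2. *)
Lemma form_bound :
  \sum_(k | even k) x k ^+ 2 -
    \sum_(k | ~~ even k) (f (left_region col k) - f (right_region col k)) ^+ 2
  <= word_form [seq (col k, x k) | k <- enum 'I_N].
Proof.
rewrite word_form_sum.
pose h k := f (left_region col k) - f (right_region col k).
set S := \sum_(l : 'I_N) _.
(* The constants of columns are values of base, removed by sum_column_const below. *)
have lft k : ~~ even k -> \sum_(l : 'I_N | (l < k)%N && (col k == (col l).+1)) x l =
   f (left_region col k) - (if col k is j.+1 then base j else 0).
  move=> ek; rewrite /left_region; case e : (col k) => [|j].
    by rewrite big_pred0 ?hf ?subr0 // => l; rewrite andbF.
  rewrite -sum_side //; last by move: ek; rewrite /even e /=; case: odd p => [] [].
  by apply: eq_bigl => l; rewrite eqSS andbC eq_sym.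
have rgt k : ~~ even k -> \sum_(l : 'I_N | (k < l)%N && (col l == (col k).+1)) x l =
   - (f (right_region col k) - base (col k).+1).
  move=> ek; rewrite /right_region -sum_side //; last first.
    by move: ek; rewrite /even /=; case: odd p => [] [].
  by rewrite -sum_gt ?ltn_eqF //; apply: eq_bigl => l; rewrite andbC.
have -> : S = \sum_(k | ~~ even k) x k * h k.
  transitivity (\sum_(k | ~~ even k) x k * (\sum_(l : 'I_N | (l < k)%N && (col k == (col l).+1)) x l) +
     \sum_(k | ~~ even k) x k * (\sum_(l : 'I_N | (k < l)%N && (col l == (col k).+1)) x l)).
    rewrite /S; under eq_bigr => l _ do rewrite (bigID (fun k => ~~ even k)) /=.
    rewrite big_split /=; congr (_ + _).
      rewrite (exchange_big_dep (fun k => ~~ even k)) /=; last by move=> l k _ /andP[].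
      apply: eq_bigr => k ek; rewrite mulr_sumr; apply: eq_big => l; first by rewrite ek andbT.
      by rewrite mulrC.
    rewrite [RHS]big_mkcond; apply: eq_bigr => l _; case: ifP => el.
      rewrite mulr_sumr; apply: eq_bigl => k; rewrite negbK -andbA; congr (_ && _).
      by case: (boolP (col k == _)) => //= /evenS ->.
    rewrite big1 // => k /andP[/andP[_ /evenS ek]]; by rewrite ek el.
  rewrite -big_split /=.
  have := sum_column_const (fun c => base c.+1 - (if c is j.+1 then base j else 0)).
  move=> c0; rewrite -[RHS]addr0 -[X in _ + X]c0 -big_split; apply: eq_bigr => k ek.
  by rewrite lft // rgt // /h /=; ring.
rewrite (bigID even (fun _ => true)) /= -addrA lerD2l lerNl opprD mulr_sumr -!sumrN -big_split /=.
by apply: ler_sum => k _; rewrite -/(h k); have := sqr_ge0 (x k + h k); rewrite -subr_ge0; congr (0 <= _); ring.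
Qed.

End FormBound.

Section Degrees.
Variables (N : nat) (col : 'I_N -> nat).
Implicit Types k l v : 'I_N.

(** The numbers of letters of the left and of the right column in the region v.
The conditions on columns discard the letters whose left or right column is
empty, for which the region is a default value. *)
Definition ldeg v := #|[set k | ((col k).+1 == col v) && (right_region col k == v)]|.
Definition rdeg v := #|[set k | (col k == (col v).+1) && (left_region col k == v)]|.
Definition deg v := (ldeg v + rdeg v)%N.

Lemma left_region_col k : left_region col k != k -> (col k == (col (left_region col k)).+1).
Proof.
rewrite /left_region; case e : (col k) => [|j]; first by rewrite eqxx.
have [cj|cj] := eqVneq (column col j) [::]; first by rewrite region_absent ?eqxx.
by rewrite region_col.
Qed.

Lemma right_region_col k : right_region col k != k -> ((col k).+1 == col (right_region col k)).
Proof.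
rewrite /right_region.
have [cj|cj] := eqVneq (column col (col k).+1) [::]; first by rewrite region_absent ?eqxx.
by rewrite region_col.
Qed.

Section Selection.
Variables (R : realFieldType) (p : bool) (f : 'I_N -> R) (X : {set 'I_N}).
Let even k := odd (col k) == p.
Hypothesis fX : forall k, k \notin X -> f k = 0.
Hypothesis Xe : forall k, k \in X -> even k.
Hypothesis admX : forall v, v \in X ->
  (deg v <= (before col v \notin X) + (after col v \notin X))%N.
Hypothesis horX : forall k, ~~ even k ->
  ~~ ((left_region col k \in X) && (right_region col k \in X)).

Let sum_region (g : 'I_N -> 'I_N) (D : 'I_N -> {set 'I_N}) :
  (forall k, ~~ even k -> g k \in X -> k \in D (g k)) ->
  \sum_(k | ~~ even k) f (g k) ^+ 2 <= \sum_v f v ^+ 2 *+ #|D v|.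
Proof.
move=> gD.
have -> : \sum_v f v ^+ 2 *+ #|D v| = \sum_v \sum_(k in D v) f v ^+ 2.
  by apply: eq_bigr => v _; rewrite sumr_const.
rewrite (exchange_big_dep predT) //= [leLHS]big_mkcond; apply: ler_sum => k _.
case: ifP => [ek|_]; last by apply: sumr_ge0 => v _; apply: sqr_ge0.
have [gX|gX] := boolP (g k \in X); last first.
  by rewrite fX // expr0n; apply: sumr_ge0 => v _; apply: sqr_ge0.
by rewrite (bigD1 (g k)) /= ?gD // lerDl; apply: sumr_ge0 => v _; apply: sqr_ge0.
Qed.

(** A letter of the other parity meets X in one region at most, so that the left
side is at most the sum of deg v * f(v)^2. On the right, the square of a difference
is at least f(v)^2 as soon as the other end is outside X, and this occurs for at
least deg v of the two neighbours of v. *)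
Lemma selection_bound :
  \sum_(k | ~~ even k) (f (left_region col k) - f (right_region col k)) ^+ 2 <=
  \sum_(k | even k) (f k - f (before col k)) ^+ 2.
Proof.
have ne k : ~~ even k -> k \notin X by apply: contra => /Xe.
have le1 : \sum_(k | ~~ even k) (f (left_region col k) - f (right_region col k)) ^+ 2 <=
   \sum_v f v ^+ 2 *+ deg v.
  have -> : \sum_v f v ^+ 2 *+ deg v = \sum_v f v ^+ 2 *+ ldeg v + \sum_v f v ^+ 2 *+ rdeg v.
    by rewrite -big_split; apply: eq_bigr => v _; rewrite /deg mulrnDr.
  have -> : \sum_(k | ~~ even k) (f (left_region col k) - f (right_region col k)) ^+ 2 =
    \sum_(k | ~~ even k) f (right_region col k) ^+ 2 + \sum_(k | ~~ even k) f (left_region col k) ^+ 2.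
    rewrite -big_split; apply: eq_bigr => k /horX; rewrite negb_and /=.
    by case/orP=> /fX ->; rewrite ?subr0 ?sub0r ?sqrrN expr0n /= ?addr0 ?add0r.
  apply: lerD; apply: sum_region => k ek gX; rewrite inE eqxx andbT.
    by apply: right_region_col; apply: contraTneq gX => ->; apply: ne.
  by apply: left_region_col; apply: contraTneq gX => ->; apply: ne.
apply: le_trans le1 _.
have le2 : \sum_(k | even k) (f k ^+ 2 *+ (before col k \notin X) + f (before col k) ^+ 2 *+ (k \notin X)) <=
   \sum_(k | even k) (f k - f (before col k)) ^+ 2.
  apply: ler_sum => k _.
  have [_|/fX->] := boolP (k \in X); have [_|/fX->] := boolP (before col k \in X);
   rewrite ?subr0 ?sub0r ?sqrrN ?addr0 ?expr0n ?mulr0n ?mulr1n ?addr0 ?add0r //=.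
  exact: sqr_ge0.
apply: le_trans le2; rewrite big_split /=.
rewrite [X in _ <= _ + X](reindex (after col)) /=; last first.
  by apply: onW_bij; exists (before col); [apply: afterK|apply: beforeK].
rewrite [X in _ <= _ + X](eq_bigl even) => [|k]; last by rewrite /even col_after.
rewrite -big_split [leRHS]big_mkcond; apply: ler_sum => v _ /=.
rewrite afterK; have [vX|/fX->] := boolP (v \in X); last first.
  by rewrite expr0n /= !mul0rn addr0 if_same.
rewrite (Xe vX) -mulrnDr; apply: ler_wpMn2l; first exact: sqr_ge0.
exact: admX.
Qed.

End Selection.
End Degrees.

(** * Selections of regions in a reduced word *)

Section Normal.
Local Open Scope nat_scope.
Variables (N : nat) (col : 'I_N -> nat).
Implicit Types k l v : 'I_N.
Notation before := (before col).
Notation after := (after col).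
Notation deg := (deg col).
Notation ldeg := (ldeg col).
Notation rdeg := (rdeg col).
Notation left_region := (left_region col).
Notation right_region := (right_region col).

(* Every column has two letters or more, and no region contains a single letter
of the right column and none of the left one. *)
Hypothesis before_neq : forall k, before k != k.
Hypothesis normal : forall v, ~~ ((ldeg v == 0) && (rdeg v == 1)).

(** In each column, the region to be left blank is one of largest degree. This
choice is what makes the blank regions cheap in the count of marks. *)
Lemma exists_labels : exists (cut : 'I_N -> 'I_N) (lab : 'I_N -> label),
  [/\ forall v, col (cut v) = col v,
      forall v v', col v = col v' -> cut v = cut v',
      forall v, lab (cut v) = blank,
      forall v, deg v <= deg (cut v) &
      forall v, v != cut v -> fits (deg v) (lab v) &&
        admissible (lab (before v)) (deg v) (lab v) (lab (after v))].
Proof.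
have [N0 _|k0] := pickP (fun _ : 'I_N => true); last first.
  by exists id, (fun=> blank); split=> v; have := k0 v.
pose M := (\max_k col k).+1.
have cM k : col k < M by rewrite ltnS leq_bigmax.
pose good (j : 'I_M) (q : 'I_N * ('I_N -> label)) := forall k, col k = j ->
  [/\ col q.1 = j, q.2 q.1 = blank,
   deg k <= deg q.1 & k != q.1 -> fits (deg k) (q.2 k) &&
      admissible (q.2 (before k)) (deg k) (q.2 k) (q.2 (after k))].
have [F FP] : exists F, forall j, good j (F j).
  apply: fin_all_exists => j.
  have [k /eqP kj|nj] := pickP (fun k => col k == j); last first.
    by exists (N0, fun=> blank) => k /eqP; rewrite nj.
  have [|z /eqP zj zmax] := @arg_maxnP _ k (fun v => col v == j) deg.
    exact/eqP.
  have [|lab labz labP] := @cycle_labels _ (column col j) z deg (column_uniq col j).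
    by rewrite mem_column zj.
  exists (z, lab) => l lj /=; split=> //; first by apply: zmax; rewrite lj.
  move=> lz; have := labP l; rewrite mem_column lj eqxx => /(_ isT lz).
  by rewrite /before /after lj.
exists (fun v => (F (Ordinal (cM v))).1), (fun v => (F (Ordinal (cM v))).2 v).
have same v v' : col v = col v' -> Ordinal (cM v) = Ordinal (cM v').
  by move=> e; apply: val_inj.
split=> v.
- by case: (FP (Ordinal (cM v)) v erefl).
- by move=> v' /same ->.
- case: (FP (Ordinal (cM v)) v erefl) => /= e1 e2 _ _.
  by rewrite (same _ v).
- by case: (FP (Ordinal (cM v)) v erefl).
case: (FP (Ordinal (cM v)) v erefl) => /= _ _ _ h /h.
by rewrite (same (before v) v) ?col_before // (same (after v) v) ?col_after.
Qed.

Definition right_present k := column col (col k).+1 != [::].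
Definition left_present k := if col k is j.+1 then column col j != [::] else false.

Lemma sum_ldeg : \sum_v ldeg v = #|[set k | right_present k]|.
Proof.
have -> : \sum_v ldeg v = \sum_v \sum_k (((col k).+1 == col v) && (right_region k == v)).
  by apply: eq_bigr => v _; rewrite /ldeg -sum1dep_card big_mkcond /=; apply: eq_bigr => k _; case: ifP.
rewrite exchange_big -sum1dep_card [RHS]big_mkcond /=; apply: eq_bigr => k _.
rewrite (bigD1 (right_region k)) //= eqxx andbT big1 ?addn0; last first.
  by move=> v; rewrite eq_sym => /negPf ->; rewrite andbF.
rewrite /right_present /right_region.
case: (eqVneq (column col (col k).+1) [::]) => [e|e] /=.
  by rewrite region_absent // gtn_eqF.
by rewrite region_col ?eqxx.
Qed.

Lemma sum_rdeg : \sum_v rdeg v = #|[set k | left_present k]|.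
Proof.
have -> : \sum_v rdeg v = \sum_v \sum_k ((col k == (col v).+1) && (left_region k == v)).
  by apply: eq_bigr => v _; rewrite /rdeg -sum1dep_card big_mkcond /=; apply: eq_bigr => k _; case: ifP.
rewrite exchange_big -sum1dep_card [RHS]big_mkcond /=; apply: eq_bigr => k _.
rewrite (bigD1 (left_region k)) //= eqxx andbT big1 ?addn0; last first.
  by move=> v; rewrite eq_sym => /negPf ->; rewrite andbF.
rewrite /left_present /left_region; case e : (col k) => [|j]; first by rewrite e.
case: (eqVneq (column col j) [::]) => [e'|e'] /=; first by rewrite region_absent // e ltn_eqF.
by rewrite region_col ?eqxx.
Qed.

Section Cut.
Variables (cut : 'I_N -> 'I_N) (lab : 'I_N -> label).
Hypothesis col_cut : forall v, col (cut v) = col v.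
Hypothesis cut_col : forall v v', col v = col v' -> cut v = cut v'.
Hypothesis lab_cut : forall v, lab (cut v) = blank.
Hypothesis deg_cut : forall v, deg v <= deg (cut v).
Hypothesis labP : forall v, v != cut v -> fits (deg v) (lab v) &&
        admissible (lab (before v)) (deg v) (lab v) (lab (after v)).

Let Z := [set v | v == cut v].

(** Some region of the column meets a letter of the right column, and it is not of
degrees (0, 1), so the maximal degree is 2 or more. *)
Lemma deg_cut_ge2 v : right_present v -> 2 <= deg (cut v).
Proof.
rewrite /right_present => cv.
have [k kc] : exists k, col k = (col v).+1.
  case: (column col _) cv (mem_column col (col v).+1) => // k s _ /(_ k).
  by rewrite mem_head => /esym/eqP; exists k.
pose u := left_region k.
have cu : col u = col v.
  rewrite /u /left_region kc region_col //.
  by have := mem_column col (col v) v; rewrite eqxx; case: (column _ _).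
have ru : 0 < rdeg u.
  by rewrite card_gt0; apply/set0Pn; exists k; rewrite inE kc cu !eqxx.
have := normal u; rewrite (cut_col (esym cu)).
by apply: contraNT; have := deg_cut u; rewrite /deg; lia.
Qed.

(** Each letter lies in one region of each adjacent column that is not empty,
whence the degrees add up to at most 2 N, minus the number of letters without a
right column, and minus 1 for the first column. A blank region would have 1 mark at
most, or 3 if there is no right column; in the latter case its column has two
letters or more without a right column, which make up for the other 2 marks. *)
Lemma weight_total : 0 < N ->
  N + 1 <= #|Z| + \sum_(v | v \notin Z) (3 - deg v).
Proof.
move=> N0.
have s1 : 3 * N <= \sum_v (3 - deg v) + \sum_v deg v.
  rewrite -big_split /= mulnC -[X in X * _]card_ord -sum_nat_const.
  by apply: leq_sum => v _; lia.
have s2 : \sum_v deg v = #|[set k | right_present k]| + #|[set k | left_present k]|.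
  by rewrite -sum_ldeg -sum_rdeg -big_split.
have cr := cardsC [set k | right_present k]; rewrite card_ord in cr.
have cl := cardsC [set k | left_present k]; rewrite card_ord in cl.
have l1 : 0 < #|~: [set k | left_present k]|.
  have [k _ kmin] := @arg_minnP _ (Ordinal N0) predT col isT.
  rewrite card_gt0; apply/set0Pn; exists k; rewrite !inE /left_present.
  case e : (col k) => [//|j]; rewrite negbK.
  case ec : (column col j) => [//|l s]; have := mem_column col j l.
  by rewrite ec mem_head => /esym/eqP lj; have := kmin l isT; rewrite lj e ltnn.
have s3 : \sum_(v in Z) (3 - deg v) <= #|Z| + 2 * #|Z :&: ~: [set k | right_present k]|.
  have -> : #|Z :&: ~: [set k | right_present k]| = \sum_(v in Z) ~~ right_present v.
    rewrite -sum1_card big_mkcond [RHS]big_mkcond; apply: eq_bigr => v _.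
    by rewrite !inE; case: eqP; case: right_present.
  rewrite big_distrr /= -sum1_card -big_split; apply: leq_sum => v.
  rewrite inE => /eqP vc; case: (boolP (right_present v)) => [/deg_cut_ge2|_] /=.
    by rewrite -vc; lia.
  by lia.
have s4 : 2 * #|Z :&: ~: [set k | right_present k]| <= #|~: [set k | right_present k]|.
  set A := Z :&: _.
  have iA : #|after @: A| = #|A| by apply: card_imset; apply: can_inj (afterK col).
  rewrite mul2n -addnn -[X in _ + X]iA -cardsUI.
  rewrite [A :&: _](_ : _ = set0) ?cards0 ?addn0.
    apply: subset_leq_card; apply/subsetP => k; rewrite inE => /orP[|/imsetP[l]].
      by rewrite inE => /andP[].
    by rewrite !inE => /andP[_ h] ->; rewrite /right_present col_after.
  apply/setP=> k; rewrite !inE; apply/negP => /andP[/andP[/eqP kc _] /imsetP[l]].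
  rewrite !inE => /andP[/eqP lc _] ka.
  have e : cut k = cut l by apply: cut_col; rewrite ka col_after.
  by have := before_neq k; rewrite {1}ka afterK lc -e -kc eqxx.
rewrite (bigID (fun v => v \in Z)) /= in s1.
have {s3} s3 := leq_trans s3 (leq_add (leqnn _) s4).
rewrite s2 in s1; suff h a b c d e f g h : 3 * N <= a + b + (c + d) -> a <= e + f ->
  c + f = N -> d + g = N -> 0 < g -> h = e + b -> N + 1 <= h.
  exact: (h _ _ _ _ _ _ _ _ s1 s3 cr cl l1).
by lia.
Qed.

(** Whether the region to the left, across a letter in the left part of v, has
mark A. It matters only for the regions v with mark x and a single such letter. *)
Definition foreign_color v : bool :=
  if [pick k | ((col k).+1 == col v) && (right_region k == v)] is Some k
  then (lab (left_region k)).1.1 else false.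

(** The selection for the residue r modulo 4 and the color b (false for A and true
for B) takes the regions of color b in the columns congruent to r, and the regions
with x in the columns congruent to r + 2. Two selected columns that are two apart
thus have different roles. A region with x is taken for the one color that its left
neighbour does not have, to avoid two regions of the selection on both sides of a
letter; with degree 0 there is no such letter, and it is taken for both. *)
Definition selected (r : nat) (b : bool) v : bool :=
  if col v %% 4 == r then (if b then (lab v).1.2 else (lab v).1.1)
  else [&& col v %% 4 == (r + 2) %% 4, (lab v).2 &
           (deg v == 0) || (foreign_color v == b)].

Lemma lab_neq_blank v : lab v != blank -> v != cut v.
Proof. by apply: contraNneq => ->; rewrite lab_cut. Qed.

Lemma selected_lab r b v : selected r b v -> lab v != blank.
Proof.
rewrite /selected; case: ifP => _; last first.
  by case/and3P=> _ x _; apply: contraTneq x => ->.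
by case: b; apply: contraTneq => ->.
Qed.

(** Each mark A or B is counted in one of the eight selections, and each mark x in
one, or in two on a region of degree 0: this gives the weight of the label. *)
Lemma selected_total : \sum_(r < 4) \sum_b #|[set v | selected r b v]| =
  \sum_(v | v \notin Z) (3 - deg v).
Proof.
transitivity (\sum_v \sum_(r < 4) \sum_b selected r b v).
  under [RHS]eq_bigr => v _ do rewrite pair_big /=.
  rewrite [RHS]exchange_big [LHS]pair_big /=; apply: eq_bigr => -[r b] _ /=.
  by rewrite -sum1dep_card big_mkcond; apply: eq_bigr => v _; case: ifP.
rewrite [RHS]big_mkcond; apply: eq_bigr => v _.
rewrite !big_ord_recl big_ord0 !big_bool /=.
have m4 : col v %% 4 < 4 by rewrite ltn_mod.
case: ifP; rewrite inE; last first.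
  by move/negbFE/eqP=> e; rewrite /selected e lab_cut; do !case: ifP; rewrite ?andbF.
case/labP/andP=> /andP[/eqP <- /implyP x2] _.
rewrite /selected /weight.
move: (col v %% 4) m4 x2 (foreign_color v) (lab v) => m m4 x2 c [[a b] x].
case: m m4 => [|[|[|[|]]]] // _; move: x2; case: (deg v) => [|[|d]] /=;
  by case: a b x c => [] [] [] [] //= h; have := h isT.
Qed.

Variables (r : nat) (b : bool).
Hypothesis r4 : r < 4.
Let X := [set v | selected r b v].

Lemma selected_even v : v \in X -> odd (col v) == odd r.
Proof.
rewrite inE /selected; case: eqP => [<- _|_ /andP[/eqP h _]].
  by rewrite odd_mod.
by rewrite -(odd_mod (col v) (erefl : odd 4 = false)) h odd_mod // oddD addbF.
Qed.

Lemma selected_cut v : v \in X -> v \notin Z.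
Proof. by rewrite !inE => /selected_lab/lab_neq_blank. Qed.

Lemma selected_admissible v : v \in X ->
  deg v <= (before v \notin X) + (after v \notin X).
Proof.
move=> vX; have := selected_cut vX; rewrite inE => /labP/andP[_].
move: vX; rewrite !inE /selected col_before col_after /admissible.
case: ifP => _; first by case: b => -> /and3P[].
move=> /and3P[-> x _] /and3P[_ _]; rewrite x /=.
by move/leq_trans; apply; apply: leq_add; case: (lab _).2; rewrite /= ?leq_b1.
Qed.

(** Suppose that the regions u and v on the two sides of a letter k are selected.
As u has k on its right, its degree is 2 or more, so u has at most one mark, A or B. So u is in a
column congruent to r and has color b, and v has x, hence degree 1 and k as its
only letter. But v is then selected for the color that u does not have. *)
Lemma selected_horizontal k : odd (col k) != odd r ->
  ~~ ((left_region k \in X) && (right_region k \in X)).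
Proof.
move=> ek; apply/negP => /andP[aX bX].
set u := left_region k in aX; set v := right_region k in bX.
have uk : col k = (col u).+1.
  by apply/eqP/left_region_col; apply: contraNneq ek => e; apply: selected_even; rewrite -/u in e; rewrite -e.
have vk : (col k).+1 = col v.
  by apply/eqP/right_region_col; apply: contraNneq ek => e; apply: selected_even; rewrite -/v in e; rewrite -e.
have ru : 0 < rdeg u.
  by rewrite card_gt0; apply/set0Pn; exists k; rewrite inE uk !eqxx.
have lv : 0 < ldeg v.
  by rewrite card_gt0; apply/set0Pn; exists k; rewrite inE vk !eqxx.
have u2 : 2 <= deg u.
  by have := normal u; apply: contraNT; rewrite /deg; lia.
have := selected_cut aX; rewrite inE => /labP/andP[/andP[/eqP wu /implyP xu] _].
have xu0 : (lab u).2 = false by apply/negP=> /xu; rewrite ltnNge u2.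
have := selected_cut bX; rewrite inE => /labP/andP[/andP[_ /implyP xv] _].
move: aX bX; rewrite !inE /selected xu0 andbF -vk uk.
case: eqP => // ur cu.
have -> : ((col u).+2 %% 4 == r) = false by apply/eqP; move: ur r4; lia.
case/and3P=> _ x /orP[/eqP v0|/eqP fc].
  by move: lv; rewrite /deg in v0; lia.
move: (xv x) => v2; have lv1 : ldeg v = 1 by move: v2 lv; rewrite /deg; lia.
have fk : foreign_color v = (lab u).1.1.
  rewrite /foreign_color; case: pickP => [k' /andP[k1 k2]|]; last first.
    by move/(_ k); rewrite vk !eqxx.
  suff -> : k' = k by [].
  have /cards1P[x' ex] : #|[set k | ((col k).+1 == col v) && (right_region k == v)]| == 1.
    exact/eqP.
  have : k' \in [set x'] by rewrite -ex inE k1 k2.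
  have : k \in [set x'] by rewrite -ex inE vk !eqxx.
  by rewrite !inE => /eqP -> /eqP.
move: cu wu; rewrite -fc fk /weight xu0; case: (lab u).1.1 => // ->.
by move: u2; case: ifP => _ /=; lia.
Qed.

End Cut.
End Normal.

Lemma column_const (N : nat) (col : 'I_N -> nat) (T : eqType) (f : 'I_N -> T) j :
  (forall k, col k = j -> f k = f (before col k)) ->
  forall k l, col k = j -> col l = j -> f k = f l.
Proof.
move=> fb k l kj lj; have z := k.
suff H v : col v = j -> f v = f (last z (column col j)) by rewrite (H k) // (H l).
move=> vj; have : v \in column col j by rewrite mem_column vj.
have fc : {in column col j, forall i, f i = f (prev (column col j) i)}.
  by move=> i; rewrite mem_column => /eqP ij; rewrite fb // /before ij.
case e : (column col j) (column_uniq col j) fc => [//|a s] us fc.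
suff H i : (i < size (a :: s))%N -> f (nth z (a :: s) i) = f (last a s).
  by move=> vs; rewrite -(nth_index z vs) H ?index_mem.
elim: i => [|i IH] h; rewrite fc ?mem_nth // prev_nth mem_nth //.
  by rewrite /= memNindex ?nth_last //; case/andP: us.
have /= /andP[_ us'] := us.
by rewrite /= index_uniq // -(IH (ltnW h)); congr f; apply: set_nth_default; rewrite ltnW.
Qed.

Lemma sum_indicator (T : finType) (P : pred T) i :
  \sum_(k | P k) (i == k)%:R = (P i)%:R :> int.
Proof.
rewrite big_mkcond /= (bigD1 i) //= eqxx big1 ?addr0; first by case: (P i).
by move=> k ki; rewrite eq_sym (negPf ki) if_same.
Qed.

Section Family.
Variables (R : realFieldType) (N : nat) (col : 'I_N -> nat) (p : bool).
Variables (cut : 'I_N -> 'I_N) (X : {set 'I_N}).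
Hypothesis col_cut : forall v, col (cut v) = col v.
Hypothesis cut_col : forall v v', col v = col v' -> cut v = cut v'.
Hypothesis Xe : forall k, k \in X -> odd (col k) == p.
Hypothesis Xcut : forall k, k \in X -> k != cut k.
Hypothesis admX : forall v, v \in X ->
  (deg col v <= (before col v \notin X) + (after col v \notin X))%N.
Hypothesis horX : forall k, odd (col k) != p ->
  ~~ ((left_region col k \in X) && (right_region col k \in X)).

(** In a column of parity p the parameter c k is the value of f at the region k,
in the other columns it is the weight of k. There the letter cut k balances the
sum, and the parameter of that letter stays 0. *)
Definition family_weight (k : 'I_N) : {ffun 'I_N -> int} :=
  if odd (col k) == p then [ffun i => (i == k)%:R - (i == before col k)%:R]
  else if k == cut k then [ffun i => - ((col i == col k) && (i != k))%:R]
  else [ffun i => (i == k)%:R].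

Let B := [set k | (odd (col k) != p) && (k != cut k)] :|: X.

Lemma family_colsum j : \sum_(k | col k == j) family_weight k = 0.
Proof.
apply/ffunP=> i; rewrite sum_ffunE ffunE.
have [ej|ej] := boolP (odd j == p).
  under eq_bigr => k /eqP kj do rewrite /family_weight kj ej ffunE.
  rewrite sumrB sum_indicator [X in _ - X](reindex (after col)) /=; last first.
    by apply: onW_bij; exists (before col); [apply: afterK|apply: beforeK].
  rewrite [X in _ - X](eq_bigl (fun k => col k == j)) => [|k]; last by rewrite col_after.
  under [X in _ - X]eq_bigr => k _ do rewrite afterK.
  by rewrite sum_indicator subrr.
have [k /eqP kj|nj] := pickP (fun k => col k == j); last by rewrite big_pred0.
have zj : col (cut k) = j by rewrite col_cut.
have zz : cut (cut k) = cut k by apply: cut_col.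
rewrite (bigD1 (cut k)) ?zj //= {1}/family_weight zj (negPf ej) zz eqxx ffunE.
rewrite (eq_bigr (fun l => (i == l)%:R)) => [|l /andP[/eqP lj lz]].
  by rewrite sum_indicator addNr.
by rewrite /family_weight lj (negPf ej) (cut_col (_ : _ = col k)) ?lj // (negPf lz) ffunE.
Qed.

Lemma lin_eval_delta (c : 'I_N -> R) k : \sum_i c i * ((i == k)%:R : int)%:~R = c k.
Proof.
rewrite (bigD1 k) //= eqxx mulr1 big1 ?addr0 // => i /negPf ->.
by rewrite mulr0.
Qed.

Lemma lin_eval_even (c : 'I_N -> R) k : odd (col k) == p ->
  lin_eval c (family_weight k) = c k - c (before col k).
Proof.
move=> ek; rewrite /lin_eval /family_weight ek -(lin_eval_delta c k) -(lin_eval_delta c (before col k)).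
by rewrite -sumrB; apply: eq_bigr => i _; rewrite ffunE rmorphB mulrBr.
Qed.

Lemma lin_eval_odd (c : 'I_N -> R) k : odd (col k) != p -> k != cut k ->
  lin_eval c (family_weight k) = c k.
Proof.
move=> /negPf ek /negPf kz; rewrite /lin_eval /family_weight ek kz -[RHS](lin_eval_delta c k).
by apply: eq_bigr => i _; rewrite ffunE.
Qed.

(** [form_bound] and [selection_bound] give the sign. Independence: if all
weights vanish, so do the free ones, and f is constant on the columns of parity p;
it vanishes at the region of the cut, which is outside X. *)
Lemma nonneg_family_selection :
  nonneg_family R B [seq (col k, family_weight k) | k <- enum 'I_N].
Proof.
have cs j : column_sum j [seq (col k, family_weight k) | k <- enum 'I_N] = 0.
  by rewrite /column_sum big_map /= big_enum_cond family_colsum.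
split=> [j|c cB|c cB c0]; first exact: cs.
- rewrite /eval_word -map_comp /comp /=.
  pose x k := lin_eval c (family_weight k).
  pose f k := if odd (col k) == p then c k else 0.
  have fX k : k \notin X -> f k = 0.
    move=> kX; rewrite /f; case: ifP => // ek; apply: cB.
    by rewrite !inE ek (negPf kX).
  have hx k : odd (col k) == p -> x k = f k - f (before col k).
    by move=> ek; rewrite /x /f col_before ek lin_eval_even.
  have hf k : ~~ (odd (col k) == p) -> f k = 0 by move=> ek; rewrite /f (negPf ek).
  have hs j : \sum_(k | col k == j) x k = 0.
    have := column_sum_eval c j [seq (col k, family_weight k) | k <- enum 'I_N].
    by rewrite cs lin_eval0 /column_sum /eval_word -map_comp big_map /= big_enum_cond.
  apply: le_trans (form_bound hx hf hs).
  rewrite subr_ge0 [leRHS](eq_bigr (fun k => (f k - f (before col k)) ^+ 2)).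
    exact: selection_bound fX Xe admX horX.
  by move=> k /hx ->.
have {}c0 k : lin_eval c (family_weight k) = 0.
  by apply: (c0 (col k, _)); apply/mapP; exists k; rewrite ?mem_enum.
move=> i; have [iB|/cB//] := boolP (i \in B).
have [ei|ei] := boolP (odd (col i) == p); last first.
  have := iB; rewrite !inE ei => /orP[/andP[_ iz]|/Xe e]; last by rewrite e in ei.
  by rewrite -(lin_eval_odd c ei iz) c0.
have cz : c (cut i) = 0.
  apply: cB; rewrite !inE col_cut ei /=; apply/negP => /Xcut.
  by rewrite (cut_col (col_cut _)) eqxx.
rewrite -cz; apply: (@column_const _ col _ c (col i)) => // k kj.
by apply/eqP; rewrite -subr_eq0 -lin_eval_even ?c0 // kj.
Qed.
End Family.

Section Words.
Local Open Scope nat_scope.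
Variables (N : nat) (col : 'I_N -> nat).
Implicit Types k l v : 'I_N.
Let w := [seq col k | k <- enum 'I_N].

Lemma card_transversal (cut : 'I_N -> 'I_N) :
  (forall v, col (cut v) = col v) ->
  (forall v v', col v = col v' -> cut v = cut v') ->
  #|[set v | v == cut v]| = size (undup w).
Proof.
move=> col_cut cut_col; set Z := [set _ | _].
have uz : uniq [seq col z | z <- enum Z].
  rewrite map_inj_in_uniq ?enum_uniq // => a b; rewrite !mem_enum !inE.
  by move=> /eqP -> /eqP -> e; apply: cut_col; rewrite -(col_cut a) -(col_cut b).
rewrite cardE -(size_map col); apply/perm_size/uniq_perm => //; first exact: undup_uniq.
move=> j; rewrite mem_undup; apply/mapP/mapP => -[k _ ->].
  by exists k; rewrite // mem_enum.
exists (cut k); last by rewrite col_cut.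
by rewrite mem_enum inE; apply/eqP/cut_col; rewrite col_cut.
Qed.

(** The eight families have dimensions #|A r| + #|X r b|. Every letter that is not
a cut is in A r for two of the residues r, hence counts for 4 families, and the
sets X have more than N - #|Z| elements in all. The largest dimension exceeds the
mean. *)
Theorem normal_index (R : realFieldType) : 0 < N ->
  (forall k, before col k != k) ->
  (forall v, ~~ ((ldeg col v == 0) && (rdeg col v == 1))) ->
  exists2 k, nonneg_index R w k & 5 * (N - size (undup w)) < 8 * k.
Proof.
move=> N0 bef nrm.
have [cut [lab [col_cut cut_col lab_cut deg_cut labP]]] := exists_labels col.
pose Z := [set v | v == cut v].
pose X r b := [set v | selected col lab r b v].
pose A r := [set k | (odd (col k) != odd r) && (k != cut k)].
have AX r b : #|A r :|: X r b| = #|A r| + #|X r b|.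
  rewrite cardsU [_ :&: _](_ : _ = set0) ?cards0 ?subn0 //.
  apply/setP=> k; rewrite in_setI in_set0; apply/negP=> /andP[].
  rewrite inE => /andP[h _] /selected_even; by rewrite (negPf h).
have sA : \sum_(r < 4) \sum_(b : bool) #|A r| = 4 * (N - #|Z|).
  have eZ : N - #|Z| = \sum_k (k != cut k).
    transitivity #|~: Z|; first by have := cardsC Z; rewrite card_ord; lia.
    rewrite -sum1_card big_mkcond.
    by apply: eq_bigr => k _; rewrite !inE; case: eqP.
  rewrite eZ big_distrr /=.
  under eq_bigr => r _ do rewrite sum_nat_const card_bool -sum1dep_card big_mkcond big_distrr /=.
  rewrite exchange_big; apply: eq_bigr => k _; rewrite !big_ord_recl big_ord0 /=.
  by case: (odd (col k)); case: (k == cut k).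
have sX := selected_total lab_cut labP; rewrite -/X in sX.
have := weight_total bef nrm cut_col deg_cut N0; rewrite -/Z -sX => wt.
have /existsP[r /existsP[b rb]] :
    [exists r : 'I_4, [exists b, 5 * (N - #|Z|) < 8 * #|A r :|: X r b|]].
  apply: contraT => /existsPn h.
  have : \sum_(r < 4) \sum_(b : bool) 8 * #|A r :|: X r b| <=
         \sum_(r < 4) \sum_(b : bool) 5 * (N - #|Z|).
    apply: leq_sum => r _; apply: leq_sum => b _; rewrite leqNgt.
    by have /existsPn := h r; apply.
  rewrite !sum_nat_const !card_bool card_ord.
  under eq_bigr => r _ do (under eq_bigr => b _ do rewrite AX // mulnDr; rewrite big_split /=).
  rewrite big_split /=; under eq_bigr => r _ do rewrite -big_distrr /=.
  rewrite -big_distrr /= sA.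
  under [X in _ + X]eq_bigr => r _ do rewrite -big_distrr /=.
  rewrite -big_distrr /=; have arith (x m z : nat) : z <= m -> m + 1 <= z + x ->
      8 * (4 * (m - z)) + 8 * x <= 4 * (2 * (5 * (m - z))) -> false by lia.
  by apply: arith wt; rewrite -[leqRHS]card_ord max_card.
exists #|A r :|: X r b|; last by rewrite -(card_transversal col_cut cut_col).
exists 'I_N, (A r :|: X r b), [seq (col k, family_weight col (odd r) cut k) | k <- enum 'I_N].
split=> //; first by rewrite /unzip1 -map_comp.
apply: nonneg_family_selection => //.
- by move=> k; apply: selected_even.
- by move=> k /(selected_cut lab_cut); rewrite inE.
- by move=> v vX; apply: (@selected_admissible _ _ cut lab).
- by move=> k kr; apply: (@selected_horizontal _ _ _ cut lab).
Qed.

End Words.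


(** * Reduction of words by braid moves *)

Section Offset.
Local Open Scope nat_scope.
Variables (N : nat) (col : 'I_N -> nat).
Implicit Types k l v : 'I_N.

(** The position of the letter k in the word rotated so that it begins at v. In this
rotation the region of v is the interval up to the next letter of its column. *)
Definition offset v k := if v <= k then k - v else k + N - v.

Lemma offset_rot v : [seq offset v k | k <- rot v (enum 'I_N)] = iota 0 N.
Proof.
have vN := ltn_ord v.
rewrite /rot map_cat -[in RHS](subnK (ltnW vN)) iotaD add0n; congr (_ ++ _).
  apply: (@eq_from_nth _ 0) => [|i]; rewrite size_map size_drop size_enum_ord ?size_iota // => h.
  rewrite (nth_map v) ?size_drop ?size_enum_ord // nth_drop nth_iota // /offset.
  by rewrite nth_enum_ord ?leq_addr ?addKn //; lia.
apply: (@eq_from_nth _ 0) => [|i]; rewrite size_map size_takel ?size_enum_ord ?size_iota ?(ltnW vN) // => h.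
rewrite (nth_map v) ?size_takel ?size_enum_ord ?(ltnW vN) // nth_take // nth_iota // /offset.
by rewrite nth_enum_ord ?(ltn_trans h) // leqNgt h /=; lia.
Qed.

Lemma offset_inj v : injective (offset v).
Proof.
move=> k l; have := ltn_ord k; have := ltn_ord l; have := ltn_ord v.
rewrite /offset => vN lN kN e; apply: val_inj => /=.
by move: e; case: ifP; case: ifP; lia.
Qed.

Lemma last_sorted (s : seq 'I_N) z l :
  sorted (fun i j : 'I_N => i < j) s -> l \in s -> l <= last z s.
Proof.
move=> srt ls; have [i ilt <-] : exists2 i, i < size s & nth z s i = l.
  by exists (index l s); rewrite ?index_mem ?nth_index.
have tr : transitive (fun i j : 'I_N => i < j) by move=> ? ? ?; apply: ltn_trans.
have s0 : 0 < size s by case: (s) ls.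
rewrite -nth_last; have := sorted_leq_nth (leT := fun i j : 'I_N => i <= j).
move=> H; apply: H => //; last by rewrite -ltnS prednK.
- by move=> ? ? ?; apply: leq_trans.
- by apply: sub_sorted srt => a b; apply: ltnW.
by rewrite inE prednK.
Qed.

(** In the word rotated to begin at v nothing wraps around: the last letter of
column j up to k is v exactly if all the others come after k. *)
Lemma region_spec j k v : col v = j -> col k != j ->
  (region col j k == v) =
  [forall l, (col l == j) ==> (l != v) ==> (offset v k < offset v l)].
Proof.
move=> vj kj; set r := region col j k.
have rj : col r = j.
  by apply: region_col; have := mem_column col j v; rewrite vj eqxx; case: column.
have spec l : col l = j -> l != r -> offset r k < offset r l.
  move=> lj lr; have lc : l \in column col j by rewrite mem_column lj.
  have srt := column_sorted col j.
  have rk : (r != k :> nat) by apply: contraNneq kj => /val_inj <-; rewrite rj.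
  have lk : (l != k :> nat) by apply: contraNneq kj => /val_inj <-; rewrite lj.
  have {}lr : (l != r :> nat) by [].
  have h : if r < k then (l < k) ==> (l <= r) else (k < l) && (l <= r).
    have tr : transitive (fun i j : 'I_N => i < j) by move=> ? ? ?; apply: ltn_trans.
    pose s := [seq l : 'I_N <- column col j | l < k].
    have ss : sorted (fun i j : 'I_N => i < j) s by apply: sorted_filter.
    have rE : r = last (last k (column col j)) s by [].
    have [s0|s0] := eqVneq s [::].
      have nlt u : u \in column col j -> k <= u.
        move=> uc; rewrite leqNgt; apply/negP => uk.
        suff : u \in s by rewrite s0.
        by rewrite mem_filter uk.
      have zc : last k (column col j) \in column col j.
        by case: (column col j) lc => //= a t _; apply: mem_last.
      rewrite rE s0 /= ltnNge nlt //=.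
      by rewrite (last_sorted _ srt lc) andbT ltn_neqAle eq_sym lk nlt.
    have : r \in s.
      by rewrite rE; case: (s) s0 => //= a t _; rewrite mem_last.
    rewrite mem_filter => /andP[-> _]; apply/implyP => llk.
    by rewrite rE; apply: last_sorted => //; rewrite mem_filter llk.
  have := ltn_ord k; have := ltn_ord l; have := ltn_ord r; move: h rk lk lr.
  rewrite /offset; case: (leqP r k); case: (leqP r l); case: (ltnP r k); lia.
apply/eqP/forallP => [<- l|fv].
  by apply/implyP => /eqP lj; apply/implyP => lr; apply: spec.
apply/eqP/negPn/negP => rv; have := fv r; rewrite rj eqxx rv /=.
have vr : v != r by rewrite eq_sym.
have := spec v vj vr; have rv' : r != v :> nat by [].
have := ltn_ord k; have := ltn_ord v; have := ltn_ord r; move: rv'.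
rewrite /offset; case: (leqP r k); case: (leqP v k); case: (leqP r v); case: (leqP v r); lia.
Qed.

End Offset.

Lemma filter1_split (T : eqType) (P : pred T) (s : seq T) :
  size (filter P s) = 1%N ->
  exists u a v, [/\ s = u ++ a :: v, P a, all (predC P) u & all (predC P) v].
Proof.
elim: s => //= a s IH; case: ifP => [Pa [/size0nil e]|Pa /IH[u [b [v [-> Pb au av]]]]].
  by exists [::], a, s; split=> //; rewrite all_predC has_filter e.
by exists (a :: u), b, v; split=> //=; rewrite Pa.
Qed.

Section Brick.
Local Open Scope nat_scope.
Variables (N : nat) (col : 'I_N -> nat).
Implicit Types k l v : 'I_N.

(** Rotate the word so that it begins at v. The region of v ends at the next letter
b of column i; between them are one letter of column i + 1, none of column i - 1,
and none of column i. *)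
Lemma brick_word v : before col v != v -> ldeg col v = 0 -> rdeg col v = 1 ->
  exists i u u' t, rot v [seq col k | k <- enum 'I_N] = i :: u ++ i.+1 :: u' ++ i :: t /\
    {in u ++ u', forall j, [&& j != i, j.+1 != i & j != i.+1]}.
Proof.
move=> bv l0 r1; set i := col v.
have vN := ltn_ord v.
have E := offset_rot v.
have [rest eE] : exists rest, rot v (enum 'I_N) = v :: rest.
  exists (drop v.+1 (enum 'I_N) ++ take v (enum 'I_N)).
  by rewrite /rot (drop_nth v) ?size_enum_ord // nth_ord_enum.
have er : [seq offset v k | k <- rest] = iota 1 N.-1.
  have N0 : 0 < N by apply: leq_ltn_trans vN.
  by move: E; rewrite eE /= -[X in iota 0 X](prednK N0) /= => -[].
have inr k : k != v -> k \in rest.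
  by move=> kv; have := mem_enum 'I_N k; rewrite -(mem_rot v) eE inE (negPf kv).
pose P k := col k == i.
have hP : has P rest.
  by apply/hasP; exists (before col v); rewrite ?inr // /P col_before.
have [g [b [t' [erest Pb nPg]]]] : exists g b t',
    [/\ rest = g ++ b :: t', P b & all (predC P) g].
  case: (split_find hP) => b g t' Pb nPg; exists g, b, t'.
  by rewrite cat_rcons all_predC.
have [eg eb] : [seq offset v k | k <- g] = iota 1 (size g) /\ offset v b = (size g).+1.
  move: er; rewrite erest map_cat /= => er.
  have sz : N.-1 = size g + (size t').+1.
    by have := congr1 size er; rewrite size_iota size_cat /= !size_map.
  move: er; rewrite sz iotaD; move/eqP; rewrite eqseq_cat ?size_map ?size_iota //.
  by case/andP=> /eqP -> /= /eqP [->]; rewrite add1n.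
have memg k : (k \in g) = (0 < offset v k <= size g).
  by rewrite -(mem_map (@offset_inj _ v)) eg mem_iota add1n ltnS.
have pos k : k != v -> 0 < offset v k.
  move=> kv; have : offset v k \in iota 1 N.-1 by rewrite -er map_f ?inr.
  by rewrite mem_iota => /andP[].
have far l : P l -> l != v -> size g < offset v l.
  move=> Pl lv; rewrite ltnNge; apply/negP => h.
  have : l \in g by rewrite memg pos.
  by move/(allP nPg); rewrite /= Pl.
have regg k : col k != i -> (region col i k == v) = (k \in g).
  move=> ki; have kv : k != v by apply: contraNneq ki => ->.
  rewrite (region_spec (v := v)) // memg pos //=; apply/forallP/idP => [/(_ b)|kg l].
    have bv' : b != v.
      apply/eqP => bv'; have := rot_uniq v (enum 'I_N).
      by rewrite enum_uniq eE erest bv' /= mem_cat mem_head orbT.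
    by rewrite (eqP Pb) eqxx bv' eb ltnS.
  apply/implyP => Pl; apply/implyP => lv; exact: leq_ltn_trans kg (far l Pl lv).
have ug : uniq g.
  have := rot_uniq v (enum 'I_N); rewrite enum_uniq eE erest /= cat_uniq.
  by case/andP=> _ /and3P[].
have gl : all (fun k => (col k).+1 != i) g.
  apply/allP=> k kg; apply/negP=> /eqP ki.
  move/eqP: l0; rewrite cards_eq0 => /eqP/setP/(_ k); rewrite inE ki eqxx /=.
  by rewrite in_set0 /right_region ki regg ?kg // -ki ltn_eqF.
have : size [seq k <- g | col k == i.+1] = 1.
  rewrite -r1 /rdeg -(card_uniqP _) ?filter_uniq //; apply: eq_card => k.
  rewrite mem_filter inE; case: eqP => //= ki.
  by rewrite /left_region ki regg // ki gtn_eqF.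
case/filter1_split=> u [a [u' [eu /eqP ai nu nu']]].
exists i, (map col u), (map col u'), (map col t').
split; first by rewrite -map_rot eE erest eu /= map_cat /= map_cat /= ai (eqP Pb) -catA.
move=> j; rewrite -map_cat => /mapP[k kuu ->].
have kg : k \in g by rewrite eu mem_cat inE; move: kuu; rewrite mem_cat => /orP[]->; rewrite ?orbT.
apply/and3P; split; [exact: (allP nPg _ kg)|exact: (allP gl)|].
by move: kuu; rewrite mem_cat => /orP[/(allP nu)|/(allP nu')].
Qed.
End Brick.

Section Main.
Local Open Scope nat_scope.
Variable R : realFieldType.

(** The first Betti number of the surface, by [homology_rank]. *)
Definition excess (w : seq nat) := size w - size (undup w).

Lemma size_undup_mem (s t : seq nat) : s =i t -> size (undup s) = size (undup t).
Proof.
by move=> st; apply/perm_size/uniq_perm; rewrite ?undup_uniq // => j; rewrite !mem_undup.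
Qed.

Lemma nonneg_index_nil : nonneg_index R [::] 0.
Proof.
exists 'I_0, set0, [::]; split; rewrite ?cards0 //.
by split=> [j|c _|c c0 _ i]; rewrite /column_sum ?big_nil // c0 ?inE.
Qed.

Lemma before_neq N (col : 'I_N -> nat) k :
  1 < count_mem (col k) [seq col l | l <- enum 'I_N] -> before col k != k.
Proof.
rewrite count_map -size_filter -/(column col (col k)) => sz.
apply/negP => /eqP bk; have ak : after col k = k by rewrite -{1}bk beforeK.
have kc : k \in column col (col k) by rewrite mem_column.
have uc := column_uniq col (col k).
case: (rot_to kc) => i [|a s] e; first by rewrite -(size_rot i) e in sz.
move: ak; rewrite /after -(next_rot i uc) e /= eqxx => ak.
by move: uc; rewrite -(rot_uniq i) e ak /= mem_head.
Qed.

(** Induction on the sum of M - j over the letters j, which decreases when a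
letter is deleted, and when a braid move replaces i (i+1) i by
(i+1) i (i+1). The excess does not change: a deleted letter takes its column
with it. If no step is possible, [normal_index] applies. *)
Theorem nonneg_index_excess (w : seq nat) :
  exists2 k, nonneg_index R w k & (5 * excess w < 8 * k) || (excess w == 0).
Proof.
pose M := (\max_(j <- w) j).+1; have : all (fun j => j < M) w.
  by apply/allP=> j jw; rewrite ltnS; apply: leq_bigmax_seq.
move: M => M; have [n] := ubnP (\sum_(j <- w) (M - j)).
elim: n w => // n IH w; rewrite ltnS => wn wM.
have [->|w0] := eqVneq w [::]; first by exists 0; [apply: nonneg_index_nil|rewrite orbT].
have [/hasP[j jw /eqP c1]|/hasPn c2] := boolP (has (fun j => count_mem j w == 1) w).
  case/splitPr: jw wn wM c1 w0 => u v wn wM c1 _.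
  have juv : j \notin u ++ v.
    by rewrite -has_pred1 has_count count_cat; move: c1; rewrite count_cat /= eqxx; lia.
  have [||k kuv ek] := IH (u ++ v).
  - apply: leq_trans wn; rewrite !big_cat big_cons /=.
    move: wM; rewrite all_cat /= => /and3P[_ jM _]; lia.
  - by move: wM; rewrite !all_cat /= => /and3P[-> _ ->].
  exists k; first exact: nonneg_index_insert.
  suff -> : excess (u ++ j :: v) = excess (u ++ v) by [].
  rewrite /excess (@size_undup_mem _ (j :: u ++ v)) /=; last first.
    by move=> x; rewrite !(inE, mem_cat) orbCA.
  by rewrite (negPf juv) !size_cat /= addnS subSS.
pose N := size w; pose col := tnth (in_tuple w).
have ew : w = [seq col k | k <- enum 'I_N] by rewrite map_tnth_enum.
have bef k : before col k != k.
  apply: before_neq; rewrite -ew; have kw : col k \in w by apply: mem_tnth.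
  have := c2 _ kw; have : 0 < count_mem (col k) w by rewrite -has_count has_pred1.
  by case: count => [|[]].
have N0 : 0 < N by rewrite lt0n size_eq0.
have [/existsP[v /andP[/eqP l0 /eqP r1]]|/existsPn nrm] :=
    boolP [exists v, (ldeg col v == 0) && (rdeg col v == 1)]; last first.
  have [k kw kn] := normal_index R N0 bef nrm; rewrite -ew in kw kn.
  by exists k => //; rewrite kn.
have [i [u [u' [t []]]]] := brick_word (bef v) l0 r1; rewrite -ew => er uu.
have pw : perm_eq w (i :: u ++ i.+1 :: u' ++ i :: t) by rewrite -er perm_sym perm_rot.
have [||k kw ek] := IH (u ++ [:: i.+1, i, i.+1 & u' ++ t]).
- apply: leq_trans wn; rewrite (perm_big _ pw) /= !(big_cat, big_cons) /=.
  move: wM; rewrite (perm_all _ pw) /= => /andP[iM _]; lia.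
- by move: wM; rewrite (perm_all _ pw) /= !all_cat /= !all_cat /= => /and5P[-> -> -> -> /andP[_ ->]].
exists k.
  have := nonneg_index_braid uu kw; rewrite -er /rot => /nonneg_index_catC.
  by rewrite cat_take_drop.
suff -> : excess w = excess (u ++ [:: i.+1, i, i.+1 & u' ++ t]) by [].
rewrite /excess (perm_size pw) (@size_undup_mem _ (u ++ [:: i.+1, i, i.+1 & u' ++ t])).
  by congr (_ - _); rewrite /= !(size_cat, size_map) /= !size_cat /=; lia.
move=> x; rewrite (perm_mem pw) !(inE, mem_cat).
by do !case: (_ == _); do !case: (_ \in _).
Qed.
End Main.

(** * Seifert forms of positive braids *)

Section Homology.
Variables (n : nat) (w : braid_word n).
Let N := size w.

Definition letter_col (k : 'I_N) : nat := (tnth (in_tuple w) k).1.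
Local Notation col := letter_col.

Definition column_word : seq nat := [seq nat_of_ord l.1 | l : 'I_n * bool <- w].

Lemma column_wordE : column_word = [seq col k | k <- enum 'I_N].
Proof.
transitivity [seq nat_of_ord l.1 | l <- [seq tnth (in_tuple w) k | k <- enum 'I_N]].
  by rewrite map_tnth_enum.
by rewrite -map_comp.
Qed.

Lemma col_lt k : (col k < n)%N. Proof. exact: ltn_ord. Qed.

Lemma boundary_entry (x : 'rV[int]_N) j :
  (x *m band_boundary w) 0 j =
  \sum_(k | (j : nat) == (col k).+1) x 0 k - \sum_(k | (j : nat) == col k) x 0 k.
Proof.
rewrite mxE [X in X - _]big_mkcond [X in _ - X]big_mkcond -sumrB /=.
apply: eq_bigr => k _; rewrite mxE mulrBr -/(col k).
by case: eqP; case: eqP; rewrite ?mulr1 ?mulr0.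
Qed.

(** The boundary at the disc j is the sum over column j - 1 minus the sum over
column j; from the disc 0 on, all column sums vanish by induction. *)
Lemma cycleP (x : 'rV[int]_N) :
  (forall j, \sum_(k | col k == j) x 0 k = 0) <-> x *m band_boundary w = 0.
Proof.
split=> [h|h].
  apply/matrixP=> i j; rewrite ord1 boundary_entry [RHS]mxE.
  have h' m : \sum_(k | m == col k) x 0 k = 0.
    by rewrite -[RHS](h m); apply: eq_bigl => k; rewrite eq_sym.
  rewrite h' subr0; case: j => [[|j] jn] /=; first by rewrite big_pred0.
  exact: h'.
have e j : (j <= n)%N ->
   \sum_(k | j == (col k).+1) x 0 k = \sum_(k | j == col k) x 0 k.
  rewrite -ltnS => jn; apply/eqP; rewrite -subr_eq0.
  by rewrite -(boundary_entry x (Ordinal jn)) h mxE.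
suff H j : (j <= n)%N -> \sum_(k | j == col k) x 0 k = 0.
  move=> j; have [jn|jn] := leqP j n.
    by rewrite -[RHS](H j) //; apply: eq_bigl => k; rewrite eq_sym.
  rewrite big_pred0 // => k; apply/negP => /eqP kj.
  by have := col_lt k; rewrite kj ltnNge ltnW.
elim: j => [|j IH] jn; rewrite -e //; first by rewrite big_pred0.
rewrite -[RHS](IH (ltnW jn)); exact: eq_bigl.
Qed.

Lemma linking_pos (R : comPzRingType) (x y : 'rV[R]_N) : positive_word w ->
  (x *m map_mx intr (band_linking w) *m y^T) 0 0 =
  \sum_(l : 'I_N) \sum_(k : 'I_N | (l < k)%N)
     x 0 k * y 0 l * ((col k == col l)%:R - (col k == (col l).+1)%:R).
Proof.
move=> wp; rewrite mxE; apply: eq_bigr => l _.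
rewrite mxE big_distrl /= big_mkcond [RHS]big_mkcond; apply: eq_bigr => k _ /=.
rewrite !mxE; have sl : (tnth (in_tuple w) l).2 = true.
  by apply: (allP wp); apply: mem_tnth.
rewrite sl andbF -!/(col _); case: ifP => _; last by rewrite mulr0 mul0r.
by rewrite mulrAC; congr (_ * _); rewrite rmorphB /=; case: eqP; case: eqP; rewrite ?rmorph1 ?rmorph0.
Qed.

(** The linking form adds the products of the weights of two letters in the
same column and subtracts those from a column and the next one. With zero column
sums, twice the first part is minus the sum of the squares. *)
Lemma linking_form (R : comPzRingType) (x : 'rV[R]_N) : positive_word w ->
  (forall j, \sum_(k | col k == j) x 0 k = 0) ->
  - 2 * (x *m map_mx intr (band_linking w) *m x^T) 0 0 =
  word_form [seq (col k, x 0 k) | k <- enum 'I_N].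
Proof.
move=> wp x0; rewrite linking_pos // word_form_sum.
pose T := \sum_(l : 'I_N) \sum_(k : 'I_N | (l < k)%N && (col k == col l)) x 0 l * x 0 k.
pose U := \sum_(l : 'I_N) \sum_(k : 'I_N | (l < k)%N && (col k == (col l).+1)) x 0 l * x 0 k.
have -> : \sum_(l : 'I_N) \sum_(k : 'I_N | (l < k)%N)
     x 0 k * x 0 l * ((col k == col l)%:R - (col k == (col l).+1)%:R) = T - U.
  rewrite -sumrB; apply: eq_bigr => l _.
  rewrite big_mkcond [X in _ = X - _]big_mkcond [X in _ = _ - X]big_mkcond -sumrB.
  apply: eq_bigr => k _; case: (l < k)%N => /=; last by rewrite subr0.
  have [->|_] := eqVneq (col k) (col l); first by rewrite ltn_eqF //=; ring.
  by case: (_ == _) => /=; ring.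
suff : \sum_k x 0 k ^+ 2 + (T + T) = 0.
  by move/eqP; rewrite addr_eq0 => /eqP ->; rewrite -/U; ring.
have T' : T = \sum_(l : 'I_N) \sum_(k : 'I_N | (k < l)%N && (col k == col l)) x 0 l * x 0 k.
  rewrite /T (exchange_big_dep (fun=> true)) //=; apply: eq_bigr => l _.
  by apply: eq_big => k; rewrite ?[col l == _]eq_sym // mulrC.
rewrite {1}T' /T -!big_split big1 //= => l _.
have e : \sum_(k | col k == col l) x 0 l * x 0 k = 0 by rewrite -mulr_sumr x0 mulr0.
rewrite -[RHS]e [RHS](bigD1 l) //= -expr2.
congr (_ + _); rewrite [RHS](bigID (fun k : 'I_N => (k < l)%N)) /=.
by congr (_ + _); apply: eq_bigl => k; rewrite -[k == l]val_eqE /=;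
  case: (col k == col l); case: ltngtP.
Qed.

End Homology.

Section Rank.
Variables (n : nat) (w : braid_word n) (r : nat) (B : 'M[int]_(r, size w)).
Hypothesis hB : homology_basis B.
Local Notation N := (size w).
Local Notation col := (@letter_col n w).

Lemma cycle_coords m (A : 'M[int]_(m, N)) :
  A *m band_boundary w = 0 -> exists D : 'M[int]_(m, r), A = D *m B.
Proof.
move=> A0; have /fin_all_exists[D hD] (i : 'I_m) : exists c : 'rV[int]_r, row i A = c *m B.
  by case: (hB.2 (row i A)) => [|c []]; [rewrite -row_mul A0 row0|exists c].
exists (\matrix_(i, j) D i 0 j); apply/row_matrixP => i; rewrite hD row_mul; congr (_ *m _).
by apply/rowP=> j; rewrite !mxE.
Qed.

Lemma basis_free (D : 'M[int]_r) : D *m B = B -> D = 1%:M.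
Proof.
move=> DB; apply/row_matrixP => i.
have [|c [_ cu]] := hB.2 (row i B); first by rewrite -row_mul hB.1 row0.
by rewrite -(cu (row i D)) ?(cu (row i 1%:M)) // -row_mul ?DB ?mul1mx.
Qed.

(** Fix one letter in each column. The rows e_k - e_(cut k) of E are cycles, so
E = D B, and subtracting these letters does not change a cycle modulo the letters
that are fixed: B E = B. Hence B D = 1, and r is the trace of D B = E, the number
of letters that are not fixed. *)
Lemma homology_rank : r = excess (column_word w).
Proof.
have [cut [_ [col_cut cut_col _ _ _]]] := exists_labels col.
pose E : 'M[int]_N := \matrix_(k, l) ((k == l)%:R - (l == cut k)%:R).
have E0 : E *m band_boundary w = 0.
  apply/row_matrixP => k; rewrite row_mul row0; apply/cycleP => j.
  under eq_bigr => l _ do rewrite !mxE [l == cut k]eq_sym.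
  by rewrite sumrB !sum_indicator col_cut subrr.
have BE : B *m E = B.
  apply/matrixP=> i l; rewrite mxE.
  under eq_bigr => k _ do rewrite mxE mulrBr.
  rewrite sumrB (bigD1 l) //= eqxx mulr1 big1 ?addr0; last first.
    by move=> k /negPf ->; rewrite mulr0.
  have /cycleP/(_ (col l)) : row i B *m band_boundary w = 0.
    by rewrite -row_mul hB.1 row0.
  have [lc|lc] := eqVneq l (cut l) => h; last first.
    rewrite big1 ?subr0 // => k _; case: eqP => [lk|_]; last by rewrite mulr0.
    case/eqP: lc; rewrite {1}lk; apply: cut_col.
    by rewrite lk col_cut.
  rewrite [X in _ - X](_ : _ = 0) ?subr0 // -[RHS]h [RHS]big_mkcond /=.
  apply: eq_bigr => k _.
  rewrite mxE; case: eqP => [lk|lk]; rewrite ?mulr1 ?mulr0.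
    by rewrite lk col_cut eqxx.
  case: eqP => // kl; case: lk; rewrite {1}lc; exact: cut_col.
have [D ED] := cycle_coords E0.
have BD : B *m D = 1%:M by apply: basis_free; rewrite -mulmxA -ED.
have : r%:R = \tr E by rewrite ED mxtrace_mulC BD mxtrace1.
have -> : \tr E = (N - #|[set v | v == cut v]|)%N%:R.
  have -> : (N - #|[set v | v == cut v]|)%N = #|[set v | v != cut v]|.
    have := cardsC [set v | v == cut v]; rewrite card_ord => e.
    rewrite -[X in (X - _)%N]e addKn; apply: eq_card => v; by rewrite !inE.
  rewrite -sum1dep_card natr_sum /mxtrace [RHS]big_mkcond; apply: eq_bigr => k _.
  by rewrite mxE eqxx /=; case: eqP => _; rewrite ?subrr ?subr0.
move/eqP; rewrite eqr_nat => /eqP ->.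
rewrite /excess column_wordE -(card_transversal col_cut cut_col) size_map size_enum_ord.
by [].
Qed.

End Rank.

Section MissingGenerator.
Variables (n : nat) (i : 'I_n) (u v : braid_word n).
Let w : braid_word n := u ++ [:: (i, true), (i, false) & v].
Hypothesis iu : i \notin [seq l.1 | l <- u].
Hypothesis iv : i \notin [seq l.1 | l <- v].
Local Notation N := (size w).
Local Notation col := (@letter_col n w).

(** The two bands of an appended pair join the same discs, with opposite signs and
no other band of that column. The cycle that goes up one of them and down the other
has linking number 0 with every cycle, on both sides, so V and V^T have a common
kernel vector. *)
Lemma missing_generator r (V : 'M[int]_r) : seifert_matrix w V ->
  \det (map_mx polyC V - 'X *: map_mx polyC V^T) = 0.
Proof.
case=> B hB eV.
have eN : N = (size u + (size v).+2)%N by rewrite /w size_cat.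
have aN : (size u < N)%N by rewrite /w size_cat /=; lia.
have bN : ((size u).+1 < N)%N by rewrite /w size_cat /=; lia.
pose a := Ordinal aN; pose b := Ordinal bN.
have ab : a != b by rewrite -val_eqE /= ltn_eqF.
have ta : tnth (in_tuple w) a = (i, true).
  by rewrite (tnth_nth (i, true)) /= /w nth_cat ltnn subnn.
have tb : tnth (in_tuple w) b = (i, false).
  by rewrite (tnth_nth (i, true)) /= /w nth_cat ltnNge leqnSn /= subSnn.
have ca : col a = i by rewrite /letter_col ta.
have cb : col b = i by rewrite /letter_col tb.
have only k : col k = i -> (k == a) || (k == b).
  rewrite /letter_col (tnth_nth (i, true)) /= /w -!val_eqE /= nth_cat.
  case: ltnP => kl.
    move=> /val_inj e; case/negP: iu; rewrite -e.
    by apply/mapP; exists (nth (i, true) u k) => //; apply: mem_nth.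
  case e : (k - size u)%N => [|[|m]] /=.
  - by move=> _; rewrite -(subnK kl) e add0n eqxx.
  - by move=> _; rewrite -(subnK kl) e add1n eqxx orbT.
  move=> /val_inj h; case/negP: iv; rewrite -h.
  apply/mapP; exists (nth (i, true) v m) => //; apply: mem_nth.
  have := ltn_ord k; rewrite [X in (_ < X)%N]eN -(subnK kl) e addnC ltn_add2l.
  by rewrite !ltnS.
pose x : 'rV[int]_N := delta_mx 0 a - delta_mx 0 b.
have colB m : B m a + B m b = 0.
  have /cycleP/(_ (col a)) : row m B *m band_boundary w = 0 by rewrite -row_mul hB.1 row0.
  rewrite (bigD1 a) //= (bigD1 b) /= ?ca ?cb ?eqxx 1?eq_sym // big1 ?addr0 ?mxE //.
  by move=> k /andP[/andP[/eqP /only /orP[]->]]; rewrite ?andbF.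
have x0 : x *m band_boundary w = 0.
  apply/cycleP => j; under eq_bigr => k _ do rewrite !mxE /= [k == a]eq_sym [k == b]eq_sym.
  by rewrite sumrB !sum_indicator ca cb subrr.
have xL : x *m band_linking w *m B^T = 0.
  have -> : x *m band_linking w = - (delta_mx 0 a + delta_mx 0 b).
    rewrite mulmxBl -!rowE; apply/rowP => l; rewrite !mxE -!/(col _) ca cb /=.
    have [->|la] := eqVneq l a.
      rewrite (negPf ab) ca /= ltnn ltnSn ta eqxx ltn_eqF ?ltnSn //=.
    have [->|lb] := eqVneq l b.
      rewrite tb /= ltnn ltnNge leqnSn /=.
      by rewrite !add0r.
    rewrite /= addr0 oppr0.
    have la' : (nat_of_ord l == size u) = false by exact: (negPf la).
    by rewrite ltnS [(l <= size u)%N]leq_eqVlt la' subrr.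
  rewrite mulNmx mulmxDl -!rowE; apply/rowP=> m; rewrite !mxE.
  by rewrite colB oppr0.
have Lx : B *m band_linking w *m x^T = 0.
  rewrite -mulmxA.
  have -> : band_linking w *m x^T = 0; last by rewrite mulmx0.
  rewrite linearB /= mulmxBr !trmx_delta -!colE; apply/colP=> m.
  rewrite !mxE -!/(col _) ca cb ta tb /=.
  rewrite andbF andbT; have [->|mb] := eqVneq m b.
    by rewrite /= ltnSn ltnn cb eqxx ltn_eqF ?ltnSn //= subr0 subrr.
  have mb' : (nat_of_ord m == (size u).+1) = false by exact: (negPf mb).
  by rewrite [((size u).+1 < m)%N]ltn_neqAle [(size u).+1 == m :> nat]eq_sym mb' /= subrr.
have [c xc] := cycle_coords hB x0.
have c0 : c != 0.
  apply/eqP=> e; have := congr1 (fun y : 'rV[int]_N => y 0 a) xc.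
  by rewrite e mul0mx !mxE /= eqxx (negPf ab).
have cV : c *m V = 0 by rewrite eV !mulmxA -xc xL.
have cVT : c *m V^T = 0.
  by rewrite -[LHS]trmxK trmx_mul trmxK eV -!mulmxA -trmx_mul -xc mulmxA Lx trmx0.
apply/eqP/det0P; exists (map_mx polyC c).
  apply: contraNneq c0 => h; apply/eqP/matrixP=> j k; apply: polyC_inj.
  by move/matrixP/(_ j k): h; rewrite !mxE.
by rewrite mulmxBr -scalemxAr -!map_mxM /= cV cVT !map_mx0 scaler0 subr0.
Qed.
End MissingGenerator.

Section Real.
Variables (R : rcfType) (n : nat) (w : braid_word n).
Hypothesis wp : positive_word w.
Variables (r : nat) (B : 'M[int]_(r, size w)).
Hypothesis hB : homology_basis B.
Let V := B *m band_linking w *m B^T.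
Local Notation N := (size w).
Local Notation col := (@letter_col n w).

(** The family is written in a basis of the integral homology, where
[linking_form] turns the sign of Q around. *)
Lemma nonpos_family k : nonneg_index R (column_word w) k ->
  exists2 K : 'M[R]_(k, r), row_free K &
    forall x : 'rV_k, (x *m K *m map_mx intr V *m (x *m K)^T) 0 0 <= 0.
Proof.
case=> I [B0 [s [<- us [s0 sQ sI]]]].
have ss : size s = N by rewrite -(size_map fst) -/(unzip1 s) us size_map.
pose a (l : 'I_N) := (nth (0%N, 0) s l).2.
have es : s = [seq (col l, a l) | l <- enum 'I_N].
  apply: (@eq_from_nth _ (0%N, 0)) => [|l]; first by rewrite size_map size_enum_ord.
  rewrite ss => lN.
  rewrite (nth_map (Ordinal lN)) ?size_enum_ord // /a nth_enum_ord //.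
  rewrite [LHS]surjective_pairing; congr (_, _).
  have := congr1 (fun t => nth 0%N t l) us; rewrite (nth_map (0%N, 0)) ?ss // => ->.
  by rewrite column_wordE (nth_map (Ordinal lN)) ?size_enum_ord // (nth_ord_enum _ (Ordinal lN)).
(* The rows of A are the cycles of the family, one for each free parameter. *)
pose A : 'M[int]_(#|B0|, N) := \matrix_(i, l) a l (enum_val i).
have A0 : A *m band_boundary w = 0.
  apply/row_matrixP => i; rewrite row_mul row0; apply/cycleP => j.
  have /ffunP/(_ (enum_val i)) := s0 j.
  rewrite es /column_sum big_map big_enum_cond /= sum_ffunE ffunE => h.
  by rewrite -[RHS]h; apply: eq_bigr => l _; rewrite !mxE.
have [D AD] := cycle_coords hB A0.
(* Extends the parameters in B0 by 0. *)
pose c0 (x : 'rV[R]_#|B0|) (i : I) : R :=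
  \sum_(j | enum_val j == i) x 0 j.
have c0B x i : i \notin B0 -> c0 x i = 0.
  move=> iB; rewrite /c0 big_pred0 // => j; apply: contraNF iB => /eqP <-.
  exact: enum_valP.
have evx x l : lin_eval (c0 x) (a l) = (x *m map_mx intr A) 0 l.
  rewrite /lin_eval /c0 mxE; under eq_bigr => i _ do rewrite mulr_suml.
  rewrite (exchange_big_dep predT) //=; apply: eq_bigr => j _.
  by rewrite (big_pred1 (enum_val j)) ?mxE // => i; rewrite eq_sym.
exists (map_mx intr D).
  rewrite -kermx_eq0; apply/eqP/row_matrixP => i; rewrite row0.
  set x := row i _; have xK : x *m map_mx intr D = 0 by rewrite -row_mul mulmx_ker row0.
  have c00 : forall i, c0 x i = 0.
    apply: sI; first exact: c0B.
    move=> p; rewrite es => /mapP[l _ ->] /=.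
    by rewrite evx AD map_mxM mulmxA xK mul0mx mxE.
  apply/rowP => j; rewrite [RHS]mxE -(c00 (enum_val j)) /c0 (big_pred1 j) // => j'.
  by rewrite (inj_eq enum_val_inj).
move=> x; set y := x *m map_mx intr A.
have yB : x *m map_mx intr D *m map_mx intr B = y by rewrite -mulmxA -map_mxM -AD.
have ys j : \sum_(l | col l == j) y 0 l = 0.
  under eq_bigr => l _ do rewrite -evx.
  have := column_sum_eval (c0 x) j s; rewrite s0 lin_eval0 {1}es /column_sum /eval_word -map_comp big_map.
  by rewrite big_enum_cond.
have := sQ (c0 x) (c0B x).
have -> : eval_word (c0 x) s = [seq (col l, y 0 l) | l <- enum 'I_N].
  by rewrite es /eval_word -map_comp; apply: eq_map => l /=; rewrite evx.
rewrite -(linking_form wp ys) mulNr oppr_ge0 pmulr_rle0 ?ltr0n //.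
by rewrite /V !map_mxM -yB -map_trmx !trmx_mul !mulmxA.
Qed.

End Real.

Section Complexify.
Variable R : rcfType.
Local Notation C := (R[i]).
Local Notation rc := (real_complex R).

Lemma conj_rc (a : R) : (rc a : C)^* = rc a.
Proof. by apply/eqP; rewrite eq_complex /= oppr0 !eqxx. Qed.

Lemma conj_i : ('i%C : C)^* = - 'i%C.
Proof. by apply/eqP; rewrite eq_complex /= oppr0 !eqxx. Qed.

Lemma conjtr_real m n (A : 'M[R]_(m, n)) : conjtr (map_mx rc A) = map_mx rc A^T.
Proof. by apply/matrixP=> i j; rewrite !mxE conj_rc. Qed.

(** A complex vector is a + i b with a and b real, and the two cross terms are
cancelled by [herm_rect]. *)
Lemma herm_real k r (V : 'M[R]_r) (K : 'M[R]_(k, r)) :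
  (forall x : 'rV_k, (x *m K *m V *m (x *m K)^T) 0 0 <= 0) ->
  forall x : 'rV[C]_k, herm (map_mx rc V) (x *m map_mx rc K) <= 0.
Proof.
move=> neg x; pose q (y z : 'rV[R]_k) := (y *m K *m V *m (z *m K)^T) 0 0.
pose a : 'rV[R]_k := map_mx (@complex.Re R) x.
pose b : 'rV[R]_k := map_mx (@complex.Im R) x.
have xab : x = map_mx rc a + 'i%C *: map_mx rc b.
  by apply/matrixP=> i j; rewrite !mxE -complexE.
have qrc y z : (map_mx rc y *m map_mx rc K *m map_mx rc V *m
   conjtr (map_mx rc z *m map_mx rc K)) 0 0 = rc (q y z).
  by rewrite -!map_mxM conjtr_real -map_mxM mxE.
have ii : 'i%C * 'i%C = -1 :> C by rewrite -expr2 sqr_i.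
have -> : x *m map_mx rc K = map_mx rc a *m map_mx rc K + 'i%C *: (map_mx rc b *m map_mx rc K).
  by rewrite {1}xab mulmxDl scalemxAl.
have eH := herm_rect ii conj_i (qrc a a) (qrc b b) (qrc b a) (qrc a b)
  (conj_rc _) (conj_rc _) (conj_rc _) (conj_rc _).
rewrite eH -rmorphD pmulr_rle0 ?ltr0n // -[0]/(rc 0) lecR.
have := neg a; have := neg b; rewrite -/(q a a) -/(q b b); lra.
Qed.

End Complexify.

(** * The Alexander polynomial *)

Section Connecting.
Variables (n : nat) (w : braid_word n).
Let used := [seq l.1 | l <- w].

Lemma connecting_word_id :
  (forall i, i \in used) -> connecting_word w = w.
Proof.
move=> all_used; rewrite /connecting_word (eq_filter (a2 := pred0)) => [|i].
  by rewrite filter_pred0 cats0.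
by rewrite all_used.
Qed.

Lemma connecting_word_missing i : i \notin used ->
  exists u v, [/\ connecting_word w = u ++ [:: (i, true), (i, false) & v],
    i \notin [seq l.1 | l <- u] & i \notin [seq l.1 | l <- v]].
Proof.
move=> iw; pose f (j : 'I_n) := [:: (j, true); (j, false)].
set L := [seq j <- enum 'I_n | j \notin used].
have iL : i \in L by rewrite mem_filter iw mem_enum.
have uL : uniq L by rewrite filter_uniq ?enum_uniq.
have memf M : i \notin M -> i \notin [seq l.1 | l <- flatten [seq f j | j <- M]].
  apply: contra => /mapP[l /flatten_mapP[j jM lj] ->].
  by move: lj; rewrite !inE => /orP[]/eqP ->.
rewrite /connecting_word -/used -/L; case/splitPr: iL uL => L1 L2.
rewrite cat_uniq /= negb_or => /and4P[_ /andP[i1 _] i2 _].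
exists (w ++ flatten [seq f j | j <- L1]), (flatten [seq f j | j <- L2]).
split; last exact: memf.
  by rewrite map_cat flatten_cat /= -catA.
by rewrite map_cat mem_cat negb_or iw memf.
Qed.

End Connecting.

Lemma pencil_intr (C : numClosedFieldType) r (V : 'M[int]_r) :
  map_poly intr (\det (map_mx polyC V - 'X *: map_mx polyC V^T)) =
  pencil (map_mx intr V : 'M[C]_r).
Proof.
rewrite -det_map_mx; congr (\det _); apply/matrixP=> i j.
rewrite !mxE rmorphB rmorphM /= !map_polyC map_polyX /=.
by congr (_ - _ * _%:P); rewrite rmorph_int.
Qed.

Theorem corollary3 (R : realType) (n : nat) (w : braid_word n)
    (P : {poly int}) (s : seq R[i]) :
  positive_word w ->
  alexander_polynomial w P ->
  laurent_zeroes (map_poly intr P) s ->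
  (0 < size s)%N ->
  (size s < 4 * count (fun z : R[i] => (`|z| == 1)%R) s)%N.
Proof.
move=> wp [r [V [hV [a [b [e eP]]]]]] [s0 [c [k [c0 Ps]]]] sgt.
have P0 : map_poly intr P != 0 :> {poly R[i]}.
  rewrite Ps scaler_eq0 (negPf c0) mulf_eq0 expf_eq0 polyX_eq0 andbF /=.
  by rewrite monic_neq0 ?monic_prod_XsubC.
have det0 : \det (map_mx polyC V - 'X *: map_mx polyC V^T) != 0.
  apply: contraNneq P0 => d0; move/eqP: eP; rewrite d0 mulr0 mulf_eq0 expf_eq0.
  by rewrite polyX_eq0 andbF => /eqP ->; rewrite map_poly0.
have used i : i \in [seq l.1 | l <- w].
  apply: contraNT det0 => /connecting_word_missing[u [v [ew iu iv]]].
  by rewrite (missing_generator iu iv) // -ew.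
rewrite (connecting_word_id used) in hV.
have [B hB eV] := hV.
have [m /(nonpos_family wp hB)[K fK nK] hm] := nonneg_index_excess R (column_word w).
rewrite -(homology_rank hB) in hm.
pose rc := real_complex R.
have eVC : map_mx rc (map_mx intr V) = map_mx intr V :> 'M[R[i]]_r.
  by apply/matrixP=> i j; rewrite !mxE /rc rmorph_int.
have fK' : row_free (map_mx rc K) by rewrite row_free_map.
rewrite -eV in nK; have nK' := herm_real nK; rewrite -/rc eVC in nK'.
set p := \det _ in eP det0; have epC : map_poly intr p = pencil (map_mx intr V : 'M[R[i]]_r).
  exact: pencil_intr.
have pC0 : pencil (map_mx intr V : 'M[R[i]]_r) != 0.
  rewrite -epC; apply: contraNneq det0 => p0; apply/eqP/polyP=> j.
  have /eqP := congr1 (fun q : {poly R[i]} => q`_j) p0.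
  by rewrite coef_map coef0 /= intr_eq0 => /eqP ->; rewrite coef0.
have [t [t1 mt tp]] := unit_circle_roots pC0 fK' nK'.
have eC : 'X^a * (c *: ('X^k * \prod_(z <- s) ('X - z%:P))) =
   (-1) ^+ e * 'X^b * pencil (map_mx intr V : 'M[R[i]]_r).
  rewrite -Ps -epC; move/(congr1 (map_poly (intr : int -> R[i]))): eP.
  by rewrite !rmorphM /= !map_polyXn rmorphXn rmorphN1.
(* The units of the Laurent ring are powers of X, which have no zero on the circle. *)
have ts : (size t <= count (fun z : R[i] => (`|z| == 1)%R) s)%N.
  apply: (@unit_circle_count _ t s (a + k)) => //.
  rewrite -(dvdpZr _ _ c0) exprD -mulrA scalerAr eC.
  exact: dvdp_mull.
(* Zero is not in s, so s is made of zeroes of a pencil of degree at most r. *)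
have sr : (size s <= r)%N.
  have : \prod_(z <- s) ('X - z%:P) %| pencil (map_mx intr V : 'M[R[i]]_r).
    apply: (@roots_dvdp _ s _ b s0).
    have -> : 'X^b * pencil (map_mx intr V : 'M[R[i]]_r) =
      (-1) ^+ e * ('X^a * (c *: ('X^k * \prod_(z <- s) ('X - z%:P)))).
      by rewrite eC -mulrA signrMK.
    by rewrite !dvdp_mull // dvdpZr // dvdp_mull.
  move/(dvdp_leq pC0); rewrite size_prod_XsubC.
  by move/leq_trans/(_ (size_pencil _)); rewrite ltnS.
case/orP: hm => [hm|/eqP r0].
  by move: hm mt ts sr; clear; lia.
by move: sr; rewrite r0 leqn0; case: size sgt.
Qed.
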